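(* Let $n\geq1$, let $\tau\in\mathbb{R}$, and let $z_{n,\tau}$ be an eigenfunction, normalized in $L^2_r(\mathbb{R}_+)$, associated with the $n$-th eigenvalue $\zeta_n(\tau)$ of the operator $\mathfrak{g}(\tau)=-\partial_r^2-\frac1r\partial_r+(r-\tau)^2$ on $L^2_r(\mathbb{R}_+)$. Then $$\zeta_n'(\tau)=\left\langle\left(\mathfrak{h}^{\rm N}_0(\tau)-\zeta_n(\tau)\right)z_{n,\tau},\,z_{n,\tau}\right\rangle_{L^2(\mathbb{R}_+)},$$ where $\mathfrak{h}^{\rm N}_0(\tau)=-\partial_r^2+(r-\tau)^2$ is the operator on the unweighted space $L^2(\mathbb{R}_+)$ with Neumann boundary condition at $r=0$.
   Context: $L^2_r(\mathbb{R}_+)$ is the space of functions on the half-line $\mathbb{R}_+$ that are square integrable for the weight $r\,\mathrm{d}r$, and $B^1_r(\mathbb{R}_+):=\{u\in L^2_r(\mathbb{R}_+):\ u'\in L^2_r(\mathbb{R}_+),\ ru\in L^2_r(\mathbb{R}_+)\}$. For $\tau\in\mathbb{R}$, $\mathfrak{g}(\tau):=-\partial_r^2-\frac1r\partial_r+(r-\tau)^2$ is the self-adjoint operator on $L^2_r(\mathbb{R}_+)$ associated with the quadratic form $\mathfrak{q}_\tau(u):=\int_{\mathbb{R}_+}\left(|u'(r)|^2+(r-\tau)^2|u(r)|^2\right)r\,\mathrm{d}r$ with form domain $B^1_r(\mathbb{R}_+)$; its domain is $\{u\in B^1_r(\mathbb{R}_+):\ u''\in L^2_r(\mathbb{R}_+),\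 \frac1r u'\in L^2_r(\mathbb{R}_+),\ r^2u\in L^2_r(\mathbb{R}_+),\ (ru'(r))_{|r=0}=0\}$. It has compact resolvent, and $\zeta_n(\tau)$, $n\ge1$, denotes its $n$-th eigenvalue (in increasing order; the eigenvalues are simple and analytic in $\tau$). The prime in $\zeta_n'$ denotes the derivative with respect to $\tau$. The scalar product $\langle\cdot,\cdot\rangle_{L^2(\mathbb{R}_+)}$ is the unweighted one, with respect to $\mathrm{d}r$. *)

(* Defs.v *)
From HB Require Import structures.
From mathcomp Require Import all_boot all_order all_algebra.
From mathcomp Require Import all_classical all_reals all_analysis.
From mathcomp Require Export complex.

Set Implicit Arguments.
Unset Strict Implicit.
Unset Printing Implicit Defensive.

Import Order.TTheory GRing.Theory Num.Theory.
Import numFieldNormedType.Exports.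

Local Open Scope classical_set_scope.
Local Open Scope ring_scope.
Local Open Scope complex_scope.
Local Open Scope card_scope.

Section HalfLine.
Variable R : realType.
Implicit Types (u v w f g : R -> R[i]) (tau lam : R).

Local Notation mu := (@lebesgue_measure R).
Local Notation abs := (@ComplexField.Normc.normc R).

Definition halfline : set R := `]0, +oo[.

(* Elements of L^2 spaces are functions on R; only their values almost
   everywhere on the half-line are relevant. *)
Definition aeeq u v : Prop := u = v %[ae mu in halfline].

Definition cmeasurable u : Prop :=
  measurable_fun halfline (fun r => complex.Re (u r)) /\
  measurable_fun halfline (fun r => complex.Im (u r)).

Definition cintegrable (D : set R) u : Prop :=
  mu.-integrable D (fun r => (complex.Re (u r))%:E) /\
  mu.-integrable D (fun r => (complex.Im (u r))%:E).

Definition cintegral (D : set R) u : R[i] :=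
  (\int[mu]_(r in D) complex.Re (u r))%R +i* (\int[mu]_(r in D) complex.Im (u r))%R.

Definition sqnorm u : \bar R :=
  (\int[mu]_(r in halfline) ((abs (u r)) ^+ 2)%:E)%E.

Definition sqnorm_r u : \bar R :=
  (\int[mu]_(r in halfline) ((abs (u r)) ^+ 2 * r)%:E)%E.

Definition L2 u : Prop := cmeasurable u /\ (sqnorm u < +oo)%E.

Definition L2r u : Prop := cmeasurable u /\ (sqnorm_r u < +oo)%E.

Definition inner u v : R[i] :=
  cintegral halfline (fun r => u r * conjc (v r)).

(* u is locally absolutely continuous on the open half-line, with a.e.
   derivative v, that is, u is the continuous representative of a function
   whose distributional derivative is the locally integrable function v. *)
Definition ac_deriv u v : Prop := forall a b : R, 0 < a -> a <= b ->
  cintegrable `[a, b] v /\ u b - u a = cintegral `[a, b] v.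

Definition mulpow (k : nat) u : R -> R[i] := fun r => (r ^+ k)%:C * u r.

Definition divr u : R -> R[i] := fun r => (r^-1)%:C * u r.

(* In the predicates below u1 and u2 stand for u' and u''. *)
Definition B1r u u1 : Prop :=
  [/\ ac_deriv u u1, L2r u, L2r u1 & L2r (mulpow 1 u)].

Definition dom_g u u1 u2 : Prop :=
  [/\ B1r u u1,
      ac_deriv u1 u2 /\ L2r u2,
      L2r (divr u1),
      L2r (mulpow 2 u)
    & (fun r => r * abs (u1 r)) @ 0^'+ --> (0 : R)].

(* Graph of the operator g(tau) on L^2_r: f = g(tau) u. *)
Definition op_g tau u f : Prop :=
  [/\ L2r u, L2r f
    & exists w w1 w2, [/\ aeeq u w, dom_g w w1 w2
      & aeeq f (fun r => - w2 r - divr w1 r + ((r - tau) ^+ 2)%:C * w r)]].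

Definition B1 u u1 : Prop :=
  [/\ ac_deriv u u1, L2 u, L2 u1 & L2 (mulpow 1 u)].

Definition dom_h u u1 u2 : Prop :=
  [/\ B1 u u1,
      ac_deriv u1 u2 /\ L2 u2,
      L2 (mulpow 2 u)
    & (fun r => abs (u1 r)) @ 0^'+ --> (0 : R)].

(* Graph of the Neumann operator h_0^N(tau) on the unweighted L^2. *)
Definition op_h tau u f : Prop :=
  [/\ L2 u, L2 f
    & exists w w1 w2, [/\ aeeq u w, dom_h w w1 w2
      & aeeq f (fun r => - w2 r + ((r - tau) ^+ 2)%:C * w r)]].

Definition eigenfunction tau lam u : Prop :=
  op_g tau u (fun r => lam%:C * u r) /\ ~ aeeq u (fun=> 0).

Definition eigenvalue tau lam : Prop := exists u, eigenfunction tau lam u.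

(* For n >= 1.  The eigenvalues being simple, counting the distinct ones below
   lam is the same as counting them with multiplicity. *)
Definition nth_eigenvalue tau (n : nat) lam : Prop :=
  eigenvalue tau lam /\
  [set nu | eigenvalue tau nu /\ nu < lam] #= `I_(n.-1).

(* At most one lam satisfies nth_eigenvalue tau n lam. *)
Definition zeta (n : nat) tau : R := xget 0 (nth_eigenvalue tau n).

End HalfLine.

(* Main.v *)
Require Import Defs.
From HB Require Import structures.
From mathcomp Require Import finmap.
From mathcomp Require Import all_boot all_order all_algebra.
From mathcomp Require Import all_classical all_reals all_analysis.
From mathcomp Require Import measurable_realfun ring lra.
Import Order.TTheory GRing.Theory Num.Theory.
Import numFieldNormedType.Exports.
Local Open Scope classical_set_scope.
Local Open Scope ring_scope.
Local Open Scope complex_scope.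
Set Implicit Arguments.
Unset Strict Implicit.
Unset Printing Implicit Defensive.

(** Everything is read off the solution of the eigenvalue equation

      r u'' + u' = r V u,    V (r) = (r - tau) ^ 2 - lam,

    that is regular at the origin, normalized by u (0) = 1.  It is the sum of
    an everywhere convergent power series, written [phi tau lam] below.

    Identification of the spectrum.  The condition (r u') (0) = 0 in the domain
    of the operator makes the Wronskian of an eigenfunction with [phi] vanish,
    so that the eigenfunction is a complex multiple of [phi] ([regular_at0],
    [op_g_regular]).  Where V >= 1 there is a dichotomy: either u and u' + u
    have the same sign at some point, and then |u| stays away from zero
    ([growing_persists]), or u and u' decay like exp (- r)
    ([recessive_decaying]).  Hence lam is an eigenvalue exactly when [phi] decays
    ([eigenvalueP]), and this problem can be treated by shooting.

    Persistence of eigenvalues.  Growth with a given sign is an open condition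
    on (tau, lam), because [phi] depends continuously on its parameters
    ([phi_param_cont]).  Near an eigenvalue the Wronskian of two solutions for
    the same tau is close to (lam2 - lam1) int r u ^ 2; its sign shows that there
    is at most one eigenvalue nearby and that solutions on either side of it grow
    with opposite signs, so that for tau' near tau there is exactly one
    ([decaying_perturb]).  Compactness excludes new eigenvalues in between, and
    counting gives that the n-th eigenvalue exists and is continuous near tau
    ([nth_eigenvalue_perturb]).  Since eigenvalues are positive, the value 0
    that [zeta] takes when there is no n-th eigenvalue is never an eigenvalue
    ([zeta_nth]).

    The derivative.  For two eigenpairs, the derivative of
    r (u1' u2 - u1 u2') is r (V1 - V2) u1 u2, and its integral over the half-line
    vanishes.  As the eigenfunctions converge uniformly with an exponential
    weight ([decaying_close]), the increments satisfy

      dlam int r u ^ 2 + dtau int 2 r (r - tau) u ^ 2 = o (|dtau| + |dlam|)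

    ([eigenvalue_increment]), which is the Hellmann-Feynman formula
    zeta' = - int 2 r (r - tau) u ^ 2 for normalized u ([zeta_drv]).

    The Neumann pairing.  On an eigenfunction the one-dimensional operator gives
    h u = lam u + u' / r, so that the right-hand side of the theorem is
    int u u' / r.  The two integrals agree because

      (r V u ^ 2 - r u' ^ 2 - u u')' = 2 r (r - tau) u ^ 2 + u u' / r

    and the bracket vanishes at both ends ([virial]). *)


(** * Derivatives on the real line *)
Section Calculus.
Variable R : realType.
Implicit Types (f g u v : R -> R) (a b c d x r K : R).

Lemma drv_eq f x d d' : is_derive x 1 f d -> d = d' -> is_derive x 1 f d'.
Proof. by move=> + <-. Qed.

Lemma drv_cst c x : is_derive x 1 (fun=> c) 0.
Proof. exact: is_derive_cst. Qed.

Lemma drv_id x : is_derive x 1 (fun y : R => y) 1.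
Proof. exact: is_derive_id. Qed.

Lemma drvD f g x df dg : is_derive x 1 f df -> is_derive x 1 g dg ->
  is_derive x 1 (fun y => f y + g y) (df + dg).
Proof. by move=> hf hg; apply: (@is_deriveD _ _ _ f g). Qed.

Lemma drvN f x df : is_derive x 1 f df -> is_derive x 1 (fun y => - f y) (- df).
Proof. by move=> hf; apply: (@is_deriveN _ _ _ f). Qed.

Lemma drvM f g x df dg : is_derive x 1 f df -> is_derive x 1 g dg ->
  is_derive x 1 (fun y => f y * g y) (df * g x + f x * dg).
Proof.
move=> hf hg; have := @is_deriveM _ _ f g x 1 df dg hf hg.
by move/drv_eq; apply; rewrite /GRing.scale /= addrC mulrC.
Qed.

Lemma drvX f n x df : is_derive x 1 f df ->
  is_derive x 1 (fun y => f y ^+ n) (n%:R * f x ^+ n.-1 * df).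
Proof. by move=> hf; have := is_deriveX n hf; rewrite exprfctE. Qed.

Lemma drv_exp f x df : is_derive x 1 f df ->
  is_derive x 1 (fun y => expR (f y)) (expR (f x) * df).
Proof. by move=> hf; exact: (@is_derive1_comp _ expR f). Qed.

Lemma drv_cont f x d : is_derive x 1 f d -> {for x, continuous f}.
Proof. by case=> /derivable1_diffP /differentiable_continuous. Qed.

End Calculus.

(** Differentiates an expression whose atoms have their derivatives among the
    hypotheses; the value found is then compared with the expected one by
    [drv_eq]. *)
Ltac drv := repeat first
 [ eassumption | eapply drv_cst | eapply drv_id | eapply drvD | eapply drvN
 | eapply drvX | eapply drvM | eapply drv_exp].

Section DerivativeSign.
Variable R : realType.
Implicit Types (f g u v : R -> R) (a b c d x r K : R).

Lemma drv_mvt f f' a b : a <= b ->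
  (forall x, a <= x <= b -> is_derive x 1 f (f' x)) ->
  exists c, a <= c <= b /\ f b - f a = f' c * (b - a).
Proof.
move=> ab df; have [||c] := @MVT_segment R f f' a b ab.
- by move=> x; rewrite in_itv/= => /andP[h1 h2]; apply: df; rewrite !ltW.
- apply: derivable_within_continuous => x; rewrite in_itv/= => h.
  by case: (df x h).
by rewrite in_itv /= => h1 h2; exists c.
Qed.

Lemma drv_nondecr f f' a b : a <= b ->
  (forall x, a <= x <= b -> is_derive x 1 f (f' x)) ->
  (forall x, a <= x <= b -> 0 <= f' x) -> f a <= f b.
Proof.
move=> ab df f0; have [c [cab E]] := drv_mvt ab df.
by rewrite -subr_ge0 E mulr_ge0 ?f0// subr_ge0.
Qed.

Lemma drv_nonincr f f' a b : a <= b ->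
  (forall x, a <= x <= b -> is_derive x 1 f (f' x)) ->
  (forall x, a <= x <= b -> f' x <= 0) -> f b <= f a.
Proof.
move=> ab df f0; have [c [cab E]] := drv_mvt ab df.
by rewrite -subr_le0 E mulr_le0_ge0 ?f0// subr_ge0.
Qed.

(** A cooperative system [X' = a Z], [Z' = b X] with [a, b >= 0] cannot leave
    the quadrant [X, Z > 0], because the product [X Z] is nondecreasing. *)
Lemma cooperative_increasing (X Z al be : R -> R) a :
  (forall x, a <= x -> is_derive x 1 X (al x * Z x)) ->
  (forall x, a <= x -> is_derive x 1 Z (be x * X x)) ->
  (forall x, a <= x -> 0 <= al x) -> (forall x, a <= x -> 0 <= be x) ->
  0 < X a -> 0 < Z a ->
  forall x, a <= x -> X a <= X x /\ Z a <= Z x.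
Proof.
move=> dX dZ al0 be0 Xa Za.
have P x : a <= x -> 0 < X x * Z x.
  move=> ax; apply: (@lt_le_trans _ _ (X a * Z a)); first exact: mulr_gt0.
  apply: (@drv_nondecr (fun x => X x * Z x)
     (fun x => al x * Z x ^+ 2 + be x * X x ^+ 2)) => // y /andP[ay yx].
    move: (dX y ay) (dZ y ay) => h1 h2.
    by eapply drv_eq; [drv | rewrite /=; ring].
  by rewrite addr_ge0// mulr_ge0 ?sqr_ge0// ?al0 ?be0.
have X0 x : a <= x -> 0 < X x.
  move=> ax; rewrite ltNge; apply/negP => Xx.
  have [||c cab Xc] := @IVT R X a x 0 ax.
  - apply: derivable_within_continuous => y; rewrite in_itv/= => /andP[h _].
    by case: (dX y h).
  - by rewrite ge_min le_max Xx (ltW Xa) orbT.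
  by move: cab (P c); rewrite in_itv/= => /andP[ac _] /(_ ac); rewrite Xc mul0r ltxx.
have Z0 x : a <= x -> 0 < Z x.
  by move=> ax; have := P x ax; rewrite pmulr_rgt0// X0.
move=> x ax; split.
- apply: drv_nondecr ax _ _ => y /andP[ay _]; first exact: dX.
  by rewrite mulr_ge0 ?al0// ltW// Z0.
- apply: drv_nondecr ax _ _ => y /andP[ay _]; first exact: dZ.
  by rewrite mulr_ge0 ?be0// ltW// X0.
Qed.

(** After the last point where [f >= 0], the function is negative, hence
    nondecreasing there, and could not have become negative. *)
Lemma barrier_ge0 f f' a b : a <= b ->
  (forall x, a <= x <= b -> is_derive x 1 f (f' x)) ->
  0 <= f a -> (forall x, a <= x <= b -> f x < 0 -> 0 <= f' x) -> 0 <= f b.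
Proof.
move=> ab df fa h; rewrite leNgt; apply/negP => fb.
pose S := [set x | a <= x <= b /\ 0 <= f x].
have Sa : S a by split; rewrite ?lexx.
have hS : has_sup S by split; [exists a | exists b => x [/andP[]]].
pose s := sup S.
have as_ : a <= s by apply: (ub_le_sup hS.2).
have sb : s <= b by apply: (ge_sup hS.1) => x [/andP[]].
have sab : a <= s <= b by rewrite as_ sb.
have cs := drv_cont (df s sab).
have fs : 0 <= f s.
  rewrite leNgt; apply/negP => fs.
  have : \forall x \near s, f x < 0 by apply: cvgr_lt cs _ _.
  move=> /nbhs_ballP[e /= e0 He].
  have [x Sx] := sup_adherent e0 hS.
  move=> xs; have xle := ub_le_sup hS.2 Sx.
  have : f x < 0 by apply: He; rewrite /ball /= ger0_norm ?subr_ge0// ltrBlDr -ltrBlDl.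
  by case: Sx => _ + ; rewrite leNgt => /negP.
have : f s <= f b.
  have slb : s < b by rewrite lt_neqAle sb andbT; apply/eqP => sb'; move: fs; rewrite sb' leNgt fb.
  have [c||c + E] := @MVT R f f' s b slb.
  - rewrite in_itv/= => /andP[h1 h2]; apply: df.
    by rewrite (ltW h2) andbT (le_trans as_)// ltW.
  - apply: derivable_within_continuous => y; rewrite in_itv/= => /andP[h1 h2].
    by case: (df y); rewrite ?h2 ?(le_trans as_).
  rewrite in_itv/= => /andP[h1 h2].
  have cab : a <= c <= b by rewrite (ltW h2) andbT (le_trans as_)// ltW.
  rewrite -subr_ge0 E mulr_ge0 ?subr_ge0 ?(ltW slb)//; apply: h => //.
  rewrite ltNge; apply/negP => fc.
  have : c <= s by apply: (ub_le_sup hS.2).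
  by rewrite leNgt h1.
by move=> /(le_trans fs); rewrite leNgt fb.
Qed.

(** Gronwall's inequality in differential form.  The endpoint [a] is left out
    of the second hypothesis because the equation is singular at [0]. *)
Lemma gronwall (f : R -> R) f' K d a b : a <= b -> 0 < K ->
  (forall x, a <= x <= b -> is_derive x 1 f (f' x)) ->
  (forall x, a < x <= b -> f' x <= K * f x + d) ->
  f b + d / K <= (f a + d / K) * expR (K * (b - a)).
Proof.
move=> ab K0 df hf.
have cts : {within `[a, b], continuous (fun x => expR (- (K * x)) * (f x + d / K))}.
  apply: derivable_within_continuous => y; rewrite in_itv/= => h.
  have h1 := df y h.
  have [//] : is_derive y 1 (fun x => expR (- (K * x)) * (f x + d / K))
    (expR (- (K * y)) * (f' y - (K * f y + d))).
  by eapply drv_eq; [drv | rewrite /=; field; rewrite gt_eqF].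
have [->|nab] := eqVneq a b; first by rewrite subrr mulr0 expR0 mulr1.
have alb : a < b by rewrite lt_neqAle nab.
have [x||c] := @MVT R (fun x => expR (- (K * x)) * (f x + d / K)) (fun y => expR (- (K * y)) * (f' y - (K * f y + d))) a b alb.
  rewrite in_itv/= => /andP[h1 h2].
  have h3 := df x; rewrite (ltW h1) (ltW h2) in h3; specialize (h3 isT).
  by eapply drv_eq; [drv | rewrite /=; field; rewrite gt_eqF].
  exact: cts.
rewrite in_itv/= => /andP[h1 h2] E.
have : expR (- (K * b)) * (f b + d / K) <= expR (- (K * a)) * (f a + d / K).
  rewrite -subr_le0 E mulr_le0_ge0 ?subr_ge0// mulr_ge0_le0 ?expR_ge0// subr_le0.
  by apply: hf; rewrite h1 ltW.
rewrite -(ler_pM2l (expR_gt0 (K * b))) !mulrA -!expRD subrr expR0 mul1r.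
by move=> h; apply: (le_trans h); rewrite mulrC mulrBr.
Qed.

End DerivativeSign.

(** * Everywhere convergent power series *)
Section EntireSeries.
Variable R : realType.
Implicit Types (c d : nat -> R) (x rho : R).

(** Having all [|c k| rho ^ k] bounded is equivalent to an infinite radius of
    convergence, and is the form in which a recurrence yields it. *)
Definition entire c := forall rho, 0 < rho ->
  exists C, forall k, `|c k| * rho ^+ k <= C.

Definition psum c x : R := limn (pseries c x).

(** The coefficients of [x] times the series. *)
Definition shift_coef c k : R := if k is m.+1 then c m else 0.

(** Comparison with a geometric series of ratio [1 / 2], by taking [rho] at
    least twice [|x|]. *)
Lemma entire_cvg c x : entire c -> cvgn (pseries c x).
Proof.
move=> ec; apply: normed_cvg.
have /ec[C hC] : 0 < 2 * (`|x| + 1) by rewrite mulr_gt0// ltr_wpDl.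
have C0 : 0 <= C by rewrite (le_trans _ (hC 0)) // expr0 mulr1.
apply: (@series_le_cvg _ _ (geometric C 2^-1)).
- by move=> n /=.
- by move=> n; rewrite /geometric /= mulr_ge0// exprn_ge0 ?invr_ge0.
- move=> n /=; rewrite normrM normrX.
  have p2 : 0 < (2 : R) ^+ n by rewrite exprn_gt0.
  rewrite exprVn ler_pdivlMr// -mulrA -exprMn.
  apply: le_trans (hC n); rewrite ler_wpM2l//; apply: lerXn2r.
  + by rewrite nnegrE mulr_ge0.
  + by rewrite nnegrE mulr_ge0// addr_ge0.
  + by rewrite mulrC ler_wpM2l// lerDl.
- by apply: is_cvg_geometric_series; rewrite ger0_norm ?invr_ge0// invf_lt1// ltr1n.
Qed.

Lemma entire_diffs c : entire c -> entire (pseries_diffs c).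
Proof.
move=> ec rho rho0; have /ec[C hC] : 0 < 2 * rho by rewrite mulr_gt0.
exists (C / rho) => k; rewrite /pseries_diffs normrM normr_nat ler_pdivlMr//.
apply: le_trans (hC k.+1).
have -> : k.+1%:R * `|c k.+1| * rho ^+ k * rho = k.+1%:R * (`|c k.+1| * rho ^+ k.+1).
  by rewrite exprSr; ring.
rewrite exprMn [leRHS]mulrCA ler_wpM2r//; last by rewrite -natrX ler_nat ltnW// ltn_expl.
by rewrite mulr_ge0// exprn_ge0// ltW.
Qed.

Lemma psum_drv c x : entire c ->
  is_derive x 1 (psum c) (psum (pseries_diffs c) x).
Proof.
move=> ec; apply: (@pseries_snd_diffs _ c (`|x| + 1)).
- exact: entire_cvg.
- exact/entire_cvg/entire_diffs.
- exact/entire_cvg/entire_diffs/entire_diffs.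
- by rewrite [ltRHS]ger0_norm ?addr_ge0// ltrDl.
Qed.

Lemma psum0 c : psum c 0 = c 0%N.
Proof.
apply: lim_near_cst => //; near=> n.
have : (0 < n)%N by near: n; exists 1%N.
move: (n) => [//|m _]; rewrite /pseries /series /= big_nat_recl// expr0 mulr1.
by rewrite big1 ?addr0// => i _; rewrite expr0n mulr0.
Unshelve. all: by end_near. Qed.

Lemma psum_shift c x : entire c -> psum (shift_coef c) x = x * psum c x.
Proof.
move=> ec; apply: cvg_lim => //.
rewrite -(cvg_shiftS (pseries (shift_coef c) x)).
rewrite (_ : [sequence _]_n = (fun n => x * pseries c x n)).
  by apply: cvgMr; exact: entire_cvg.
apply/funext => n; rewrite /pseries /series /= big_nat_recl//= mul0r add0r.
by rewrite mulr_sumr; apply: eq_bigr => i _; rewrite exprS mulrCA.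
Qed.

Lemma entire_shift c : entire c -> entire (shift_coef c).
Proof.
move=> ec rho rho0; have [C hC] := ec rho rho0; exists (Num.max 0 (C * rho)).
case=> [|k] /=; first by rewrite normr0 mul0r le_max lexx.
by rewrite le_max exprSr mulrA ler_wpM2r ?orbT// ltW.
Qed.

Lemma entireD c d : entire c -> entire d -> entire (fun k => c k + d k).
Proof.
move=> ec ed rho r0; have [C hC] := ec _ r0; have [D hD] := ed _ r0.
exists (C + D) => k; apply: le_trans (lerD (hC k) (hD k)).
by rewrite -mulrDl ler_wpM2r ?exprn_ge0 ?(ltW r0)// ler_normD.
Qed.

Lemma entireZ (al : R) c : entire c -> entire (fun k => al * c k).
Proof.
move=> ec rho r0; have [C hC] := ec _ r0.
by exists (`|al| * C) => k; rewrite normrM -mulrA ler_wpM2l.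
Qed.

Lemma psumD c d x : entire c -> entire d ->
  psum (fun k => c k + d k) x = psum c x + psum d x.
Proof.
move=> ec ed; apply: cvg_lim => //.
rewrite [X in X @ _ --> _](_ : _ = (fun n => pseries c x n + pseries d x n)).
  by apply: cvgD; exact: entire_cvg.
apply/funext => n; rewrite /pseries /series /= -big_split/=.
by apply: eq_bigr => i _; rewrite mulrDl.
Qed.

Lemma psumZ (al : R) c x : entire c ->
  psum (fun k => al * c k) x = al * psum c x.
Proof.
move=> ec; apply: cvg_lim => //.
rewrite [X in X @ _ --> _](_ : _ = (fun n => al * pseries c x n)).
  by apply: cvgMr; exact: entire_cvg.
apply/funext => n; rewrite /pseries /series /= mulr_sumr.
by apply: eq_bigr => i _; rewrite mulrA.
Qed.

End EntireSeries.

(** * The solution regular at the origin *)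
Section RegularSolution.
Variable R : realType.
Implicit Types (tau lam x r : R).

(** The last four coefficients, for the recurrence
    [(k + 1) ^ 2 a_(k + 1) = (tau ^ 2 - lam) a_(k - 1) - 2 tau a_(k - 2) + a_(k - 3)]
    obtained by comparing powers of [r] in the equation. *)
Fixpoint coef_state tau lam (k : nat) : R * R * R * R :=
  if k is k'.+1 then
    let: (a0, a1, a2, a3) := coef_state tau lam k' in
    (((tau ^+ 2 - lam) * a1 - 2 * tau * a2 + a3) / (k%:R ^+ 2), a0, a1, a2)
  else (1, 0, 0, 0).

Definition coef tau lam k : R := (coef_state tau lam k).1.1.1.

Lemma coef_stateE tau lam k : coef_state tau lam k =
  (coef tau lam k, shift_coef (coef tau lam) k,
   shift_coef (shift_coef (coef tau lam)) k,
   shift_coef (shift_coef (shift_coef (coef tau lam))) k).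
Proof.
elim: k => [//|k IH]; rewrite /coef /=; move: IH.
by case: (coef_state tau lam k) => [[[a0 a1] a2] a3] [-> -> -> _].
Qed.

Lemma coef_rec tau lam k : k.+1%:R ^+ 2 * coef tau lam k.+1 =
  (tau ^+ 2 - lam) * shift_coef (coef tau lam) k
  - 2 * tau * shift_coef (shift_coef (coef tau lam)) k
  + shift_coef (shift_coef (shift_coef (coef tau lam))) k.
Proof.
have k0 : k.+1%:R ^+ 2 != 0 :> R by rewrite expf_neq0// pnatr_eq0.
rewrite {1}/coef /= coef_stateE /=; by rewrite mulrC divfK.
Qed.

(** Once [(k+1)^2] exceeds [A = |tau^2 - lam| rho^2 + |2 tau| rho^3 + rho^4], the
    recurrence no longer increases the running maximum of [|a_k| rho^k]. *)
Lemma coef_entire tau lam : entire (coef tau lam).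
Proof.
move=> rho rho0; set a := coef tau lam.
pose b k := `|a k| * rho ^+ k.
have bdd k : exists C, forall j, (j <= k)%N -> b j <= C.
  elim: k => [|k [C hC]]; first by exists (b 0%N) => j; rewrite leqn0 => /eqP ->.
  exists (Num.max C (b k.+1)) => j; rewrite leq_eqVlt ltnS le_max.
  by move=> /orP[/eqP->|/hC ->//]; rewrite lexx orbT.
set A := `|tau ^+ 2 - lam| * rho ^+ 2 + `|2 * tau| * rho ^+ 3 + rho ^+ 4.
have A0 : 0 <= A.
  by rewrite !addr_ge0 ?mulr_ge0 ?exprn_ge0 ?(ltW rho0).
pose k0 := (Num.truncn A).+1.
have [C hC] := bdd k0.
have C0 : 0 <= C by apply: le_trans (hC 0%N _) => //; rewrite /b expr0 mulr1.
have rn n : 0 <= rho ^+ n by rewrite exprn_ge0 ?(ltW rho0).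
have sh (c : nat -> R) (D : R) m k : 0 <= D ->
    (forall j, (j <= k)%N -> `|c j| * rho ^+ (j + m) <= D) ->
    forall j, (j <= k.+1)%N -> `|shift_coef c j| * rho ^+ (j + m) <= rho * D.
  move=> D0 h [|j] /=; first by rewrite normr0 mul0r mulr_ge0// ltW.
  by rewrite ltnS => /h h'; rewrite addSn exprS mulrCA ler_wpM2l// ltW.
suff H k j : (j <= k)%N -> b j <= C by exists C => k; exact: (H k k).
  (* From the index k0 on, (k + 1) ^ 2 >= A. *)
elim: k j => [|k IH] j; first by rewrite leqn0 => /eqP->; exact: hC.
rewrite leq_eqVlt ltnS => /orP[/eqP->|]; last exact: IH.
have [|kk0] := leqP k.+1 k0; first exact: hC.
have IH0 i : (i <= k)%N -> `|a i| * rho ^+ (i + 1) <= rho * C.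
  by move=> /IH h; rewrite exprD expr1 mulrA mulrC ler_wpM2l// ltW.
have s1 := sh _ _ _ _ (mulr_ge0 (ltW rho0) C0) IH0.
have s1' i : (i <= k)%N -> `|shift_coef a i| * rho ^+ (i + 1) <= rho * (rho * C).
  by move=> ik; apply: s1; rewrite leqW.
have s2 := sh _ _ _ _ _ s1'.
have D2 : 0 <= rho * (rho * C) by rewrite !mulr_ge0 ?(ltW rho0).
have {}s2 := s2 D2.
have s2' i : (i <= k)%N -> `|shift_coef (shift_coef a) i| * rho ^+ (i + 1) <= rho * (rho * (rho * C)).
  by move=> ik; apply: s2; rewrite leqW.
have s3 := sh _ _ _ _ (mulr_ge0 (ltW rho0) D2) s2'.
have {s1}s1 := s1 k (leqnSn k); have {s2}s2 := s2 k (leqnSn k).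
have {s3}s3 := s3 k (leqnSn k).
have k2 : A <= k.+1%:R ^+ 2.
  have h1 : A < k0%:R by rewrite truncnS_gt.
  apply: (le_trans (ltW h1)); rewrite -natrX ler_nat.
  by rewrite (leq_trans (ltnW kk0))// expnS expn1 leq_pmulr.
have kp : 0 < k.+1%:R ^+ 2 :> R by rewrite exprn_gt0.
rewrite -(ler_pM2l kp) /b.
have -> : k.+1%:R ^+ 2 * (`|a k.+1| * rho ^+ k.+1)
   = `|k.+1%:R ^+ 2 * a k.+1| * rho ^+ k.+1.
  by rewrite normrM mulrA (gtr0_norm kp).
rewrite coef_rec -/a; apply: (@le_trans _ _ (A * C)); last by rewrite ler_wpM2r.
rewrite -(addn1 k).
have n1 : forall x y z : R, `|x - y + z| <= `|x| + `|y| + `|z|.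
  by move=> x y z; rewrite (le_trans (ler_normD _ _))// lerD2r ler_normB.
apply: (@le_trans _ _ ((`|tau ^+ 2 - lam| * `|shift_coef a k| +
   `|2 * tau| * `|shift_coef (shift_coef a) k| +
   `|shift_coef (shift_coef (shift_coef a)) k|) * rho ^+ (k + 1))).
  by apply: ler_wpM2r => //; rewrite (le_trans (n1 _ _ _))// !normrM.
rewrite [leLHS](_ : _ = `|tau ^+ 2 - lam| * (`|shift_coef a k| * rho ^+ (k + 1)) +
   `|2 * tau| * (`|shift_coef (shift_coef a) k| * rho ^+ (k + 1)) +
   `|shift_coef (shift_coef (shift_coef a)) k| * rho ^+ (k + 1)); last by ring.
rewrite [leRHS](_ : _ = `|tau ^+ 2 - lam| * (rho * (rho * C)) +
   `|2 * tau| * (rho * (rho * (rho * C))) +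
   rho * (rho * (rho * (rho * C)))); last by rewrite /A; ring.
by rewrite !lerD// ler_wpM2l.
Qed.

Definition phi tau lam : R -> R := psum (coef tau lam).
Definition dphi tau lam : R -> R := psum (pseries_diffs (coef tau lam)).
Definition ddphi tau lam : R -> R :=
  psum (pseries_diffs (pseries_diffs (coef tau lam))).

Definition pot tau lam r : R := (r - tau) ^+ 2 - lam.

Lemma phi_drv tau lam r : is_derive r 1 (phi tau lam) (dphi tau lam r).
Proof. exact/psum_drv/coef_entire. Qed.

Lemma dphi_drv tau lam r : is_derive r 1 (dphi tau lam) (ddphi tau lam r).
Proof. exact/psum_drv/entire_diffs/coef_entire. Qed.

Lemma phi0 tau lam : phi tau lam 0 = 1.
Proof. by rewrite /phi psum0. Qed.

Lemma dphi0 tau lam : dphi tau lam 0 = 0.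
Proof.
rewrite /dphi psum0 /pseries_diffs; have := coef_rec tau lam 0.
by rewrite /= expr1n !mulr0 subrr addr0 => ->.
Qed.

Lemma phi_ode tau lam r :
  r * ddphi tau lam r + dphi tau lam r = r * pot tau lam r * phi tau lam r.
Proof.
have e0 := coef_entire tau lam; have e1 := entire_diffs e0; have e2 := entire_diffs e1.
rewrite /ddphi -psum_shift// -psumD//; last exact: entire_shift.
pose s := @shift_coef R.
transitivity (psum (fun k => (tau ^+ 2 - lam) * s (coef tau lam) k
  + (- (2 * tau) * s (s (coef tau lam)) k + s (s (s (coef tau lam))) k)) r).
  congr (psum _ r); apply/funext => k; rewrite addrA mulNr -coef_rec.
  by case: k => [|k]; rewrite /pseries_diffs /= -?[k.+2%:R]natr1; ring.
have es0 := entire_shift e0; have es1 := entire_shift es0; have es2 := entire_shift es1.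
rewrite psumD; [|exact: entireZ|by apply: entireD => //; exact: entireZ].
rewrite psumD; [|exact: entireZ|by []].
by rewrite !psumZ// !psum_shift// /pot /phi; ring.
Qed.

Lemma rdphi_drv tau lam r :
  is_derive r 1 (fun x => x * dphi tau lam x) (r * pot tau lam r * phi tau lam r).
Proof.
have h := dphi_drv tau lam r.
by eapply drv_eq; [drv | rewrite -phi_ode; ring].
Qed.

End RegularSolution.

(** * Uniqueness and dependence on parameters *)
Section OdeFacts.
Variable R : realType.
Implicit Types (tau lam x r a b e : R).

Lemma pot_bound tau lam b r : 0 <= r <= b -> `|pot tau lam r| <= (b + `|tau|) ^+ 2 + `|lam|.
Proof.
move=> /andP[r0 rb]; rewrite (le_trans (ler_normB _ _))// lerD2r normrX.
apply: lerXn2r; rewrite ?nnegrE ?addr_ge0 ?(le_trans r0 rb)//.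
by rewrite (le_trans (ler_normB _ _))// lerD2r ger0_norm.
Qed.

Lemma norm_mul2_le_sqrD (x y : R) : `|2 * x * y| <= x ^+ 2 + y ^+ 2.
Proof.
rewrite ler_norml; apply/andP; split.
  by have := sqr_ge0 (x + y); rewrite sqrrD; lra.
by have := sqr_ge0 (x - y); rewrite sqrrB; lra.
Qed.

Lemma sqr_sum_eq0 (x y : R) : x ^+ 2 + y ^+ 2 <= 0 -> x = 0 /\ y = 0.
Proof.
move=> h; have hx := sqr_ge0 x; have hy := sqr_ge0 y.
by split; apply/eqP; rewrite -sqrf_eq0; apply/eqP; lra.
Qed.

(** The energy [E = y ^ 2 + y1 ^ 2] satisfies [|E'| <= K E] on every compact
    part of the open half-line, hence vanishes as soon as it does at [a]. *)
Lemma ode_unique tau lam (y y1 : R -> R) a :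
  (forall r, 0 < r -> is_derive r 1 y (y1 r)) ->
  (forall r, 0 < r -> is_derive r 1 y1 (pot tau lam r * y r - y1 r / r)) ->
  0 < a -> y a = 0 -> y1 a = 0 -> forall r, 0 < r -> y r = 0.
Proof.
move=> dy dy1 a0 ya y1a.
pose E r := y r ^+ 2 + y1 r ^+ 2.
pose E' r := 2 * y r * y1 r + 2 * y1 r * (pot tau lam r * y r - y1 r / r).
have dE r : 0 < r -> is_derive r 1 E (E' r).
  by move=> r0; have h1 := dy r r0; have h2 := dy1 r r0;
     eapply drv_eq; [rewrite /E; drv | rewrite /E' /=; ring].
have bE (lo hi : R) : 0 < lo -> lo <= hi -> exists K : R, forall r, lo <= r <= hi -> `|E' r| <= K * E r.
  move=> lo0 lohi; set B : R := (hi + `|tau|) ^+ 2 + `|lam|.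
  exists (1 + B + 2 / lo) => r /andP[lr rh].
  have r0 : 0 < r by apply: lt_le_trans lr.
  have VB : `|pot tau lam r| <= B by apply: pot_bound; rewrite rh ltW.
  have E0 : 0 <= E r by rewrite addr_ge0 ?sqr_ge0.
  have -> : E' r = 2 * y r * y1 r + pot tau lam r * (2 * y r * y1 r) - 2 / r * y1 r ^+ 2.
    by rewrite /E'; ring.
  rewrite (le_trans (ler_normB _ _))// [leRHS]mulrDl lerD//.
    rewrite [leRHS]mulrDl mul1r (le_trans (ler_normD _ _))// lerD ?norm_mul2_le_sqrD//.
    by rewrite normrM ler_pM ?normr_ge0// norm_mul2_le_sqrD.
  rewrite normrM (ger0_norm (sqr_ge0 _)) ler_pM ?sqr_ge0//.
    by rewrite ger0_norm ?divr_ge0 ?(ltW r0)// ler_pM2l// lef_pV2.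
  by rewrite /E lerDr sqr_ge0.
have Ea : E a = 0 by rewrite /E ya y1a expr0n addr0.
move=> r r0; suff h : E r <= 0 by have [] := sqr_sum_eq0 h.
have [ar|/ltW ra] := leP a r.
- have [K hK] := bE _ _ a0 ar.
  have : E r * expR (- (K * r)) <= E a * expR (- (K * a)).
    apply: (@drv_nonincr _ (fun x => E x * expR (- (K * x)))
       (fun x => (E' x - K * E x) * expR (- (K * x)))) => // x /andP[h1 h2].
      have h := dE x (lt_le_trans a0 h1).
      by eapply drv_eq; [drv | rewrite /=; ring].
    rewrite mulr_le0_ge0 ?expR_ge0// subr_le0.
    by apply: le_trans (hK x _); rewrite ?ler_norm ?h1.
  by rewrite Ea mul0r pmulr_lle0 ?expR_gt0.
- have [K hK] := bE _ _ r0 ra.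
  have : E r * expR (K * r) <= E a * expR (K * a).
    apply: (@drv_nondecr _ (fun x => E x * expR (K * x))
       (fun x => (E' x + K * E x) * expR (K * x))) => // x /andP[h1 h2].
      have h := dE x (lt_le_trans r0 h1).
      by eapply drv_eq; [drv | rewrite /=; ring].
    rewrite mulr_ge0 ?expR_ge0// -lerBlDr sub0r.
    by rewrite lerNl; apply: le_trans (hK x _); rewrite ?h1// -normrN ler_norm.
  by rewrite Ea mul0r pmulr_lle0 ?expR_gt0.
Qed.

Lemma ddphiE tau lam r : 0 < r ->
  ddphi tau lam r = pot tau lam r * phi tau lam r - dphi tau lam r / r.
Proof.
move=> r0; apply: (mulfI (lt0r_neq0 r0)).
have -> : r * ddphi tau lam r = r * pot tau lam r * phi tau lam r - dphi tau lam r.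
  by rewrite -phi_ode addrK.
by field; rewrite gt_eqF.
Qed.

Lemma phi_cont tau lam : continuous (phi tau lam).
Proof. by move=> x; exact: drv_cont (phi_drv tau lam x). Qed.
Lemma dphi_cont tau lam : continuous (dphi tau lam).
Proof. by move=> x; exact: drv_cont (dphi_drv tau lam x). Qed.

Lemma phi_near0 tau lam : exists2 rho : R, 0 < rho &
  forall r, 0 <= r <= rho -> 1 / 2 <= phi tau lam r.
Proof.
have : \forall r \near (0 : R), 1 / 2 < phi tau lam r.
  have c0 : {for (0 : R), continuous (phi tau lam)} by exact: phi_cont.
  by apply: (cvgr_gt _ c0); rewrite phi0; lra.
move=> /nbhs_ballP[e /= e0 he]; exists (e / 2); first by rewrite divr_gt0.
move=> r /andP[r0 re]; apply/ltW/he; rewrite /ball /= sub0r normrN ger0_norm//.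
by rewrite (le_lt_trans re)// gtr_pMr// invf_lt1// ltr1n.
Qed.

(** Otherwise [phi] would vanish identically, against [phi 0 = 1]. *)
Lemma phi_nondegenerate tau lam a : 0 < a -> phi tau lam a = 0 ->
  dphi tau lam a = 0 -> False.
Proof.
move=> a0 ha h1a; have [rho rho0 h] := phi_near0 tau lam.
have /(_ rho rho0) : forall r, 0 < r -> phi tau lam r = 0.
  apply: (@ode_unique tau lam _ (dphi tau lam) a _ _ a0 ha h1a) => r r0; first exact: phi_drv.
  by rewrite -ddphiE//; exact: dphi_drv.
by have := h rho; rewrite lexx ltW// => /(_ isT) + E; rewrite E; lra.
Qed.

Lemma segment_bounded (f : R -> R) b : continuous f ->
  exists2 M : R, 0 < M & forall r, 0 <= r <= b -> `|f r| <= M.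
Proof.
move=> cf; have [b0|b0] := leP 0 b; last first.
  by exists 1 => // r /andP[h1 h2]; have := le_trans h1 h2; rewrite leNgt b0.
have cf' : {within `[0, b], continuous (fun r => `|f r|)}.
  apply: continuous_subspaceT => x.
  exact: (@continuous_comp _ _ _ f Num.norm x (cf x) (@norm_continuous _ _ _)).
have [c cb hc] := EVT_max b0 cf'.
exists (`|f c| + 1); first by rewrite ltr_wpDl.
by move=> r rb; rewrite (le_trans (hc r _)) ?lerDl// in_itv.
Qed.

(** Gronwall's inequality for [d ^ 2 + d' ^ 2], where [d] is the difference of
    two regular solutions: the singular term [- d' / r] contributes
    [- 2 d' ^ 2 / r <= 0], and so can be dropped all the way to the origin. *)
Lemma phi_param_cont tau lam b e : 0 < e -> exists2 delta : R, 0 < delta &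
  forall tau' lam', `|tau' - tau| < delta -> `|lam' - lam| < delta ->
  forall r, 0 <= r <= b -> `|phi tau' lam' r - phi tau lam r| <= e /\
                           `|dphi tau' lam' r - dphi tau lam r| <= e.
Proof.
move=> e0; have [M M0 hM] := segment_bounded b (@phi_cont tau lam).
have [b0|b0] := leP 0 b; last first.
  by exists 1 => // ? ? _ _ r /andP[h1 h2]; have := le_trans h1 h2; rewrite leNgt b0.
set B := (b + (`|tau| + 1)) ^+ 2 + (`|lam| + 1).
set K := B + 2.
have B0 : 0 <= B by rewrite addr_ge0 ?sqr_ge0 ?addr_ge0.
have K1 : 1 <= K by rewrite /K; lra.
have K0 : 0 < K by rewrite (lt_le_trans _ K1).
set L : R := 2 * `|tau| + 2 * b + 2.
have L0 : 0 < L by rewrite /L ltr_wpDl ?addr_ge0 ?mulr_ge0.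
have X0 : 0 < expR (K * b) by exact: expR_gt0.
have X1 : 1 <= expR (K * b) by rewrite -expR0 ler_expR mulr_ge0 ?(ltW K0).
set Q : R := L * M * expR (K * b).
have Q0 : 0 < Q by rewrite !mulr_gt0.
(* K bounds the growth rate of the energy, L the change of the potential per
   unit change of the parameters, and Q = L M e^(K b) the resulting change of
   the solution. *)
exists (Num.min 1 (e / Q)); first by rewrite lt_min ltr01 divr_gt0.
move=> tau' lam'; rewrite !lt_min => /andP[t1 t2] /andP[l1 l2] r rb.
set del : R := e / Q in t2 l2.
have del0 : 0 < del by rewrite divr_gt0.
have dLM : 0 <= del * L * M by apply: ltW; apply: mulr_gt0 => //; apply: mulr_gt0.
pose d x := phi tau' lam' x - phi tau lam x.
pose d1 x := dphi tau' lam' x - dphi tau lam x.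
pose d2 x := ddphi tau' lam' x - ddphi tau lam x.
pose E x := d x ^+ 2 + d1 x ^+ 2.
have dE x : is_derive x 1 E (2 * d x * d1 x + 2 * d1 x * d2 x).
  have h1 := phi_drv tau lam x; have h2 := phi_drv tau' lam' x.
  have h3 := dphi_drv tau lam x; have h4 := dphi_drv tau' lam' x.
  by eapply drv_eq; [rewrite /E /d /d1; drv | rewrite /d /d1 /d2 /=; ring].
have E0 : E 0 = 0 by rewrite /E /d /d1 !phi0 !dphi0 !subrr expr0n addr0.
set D : R := (del * L * M) ^+ 2.
have D0 : 0 <= D by exact: sqr_ge0.
have tt : `|tau'| <= `|tau| + 1.
  by rewrite -[tau'](subrK tau) (le_trans (ler_normD _ _))// addrC lerD2l ltW.
have ll : `|lam'| <= `|lam| + 1.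
  by rewrite -[lam'](subrK lam) (le_trans (ler_normD _ _))// addrC lerD2l ltW.
have EK x : 0 < x <= b -> 2 * d x * d1 x + 2 * d1 x * d2 x <= K * E x + D.
  move=> /andP[x0 xb]; have x0b : 0 <= x <= b by rewrite xb ltW.
  have V1 : `|pot tau' lam' x| <= B.
    rewrite (le_trans (pot_bound _ _ x0b))// lerD//.
    by apply: lerXn2r; rewrite ?nnegrE ?addr_ge0// lerD2l.
  have V2 : `|pot tau' lam' x - pot tau lam x| <= del * L.
    have -> : pot tau' lam' x - pot tau lam x =
      (tau' - tau) * (tau' + tau - 2 * x) - (lam' - lam) by rewrite /pot; ring.
    have h1 : `|tau' + tau - 2 * x| <= L - 1.
      rewrite (le_trans (ler_normB _ _))// (_ : L - 1 = (`|tau| + 1 + `|tau|) + 2 * b); last by rewrite /L; ring.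
      rewrite lerD// ?(le_trans (ler_normD _ _)) ?lerD2r//.
      by rewrite ger0_norm ?mulr_ge0 ?(ltW x0)// ler_pM2l.
    rewrite (le_trans (ler_normB _ _))// (_ : del * L = del * (L - 1) + del); last by ring.
    by rewrite lerD ?(ltW l2)// normrM ler_pM// ltW.
  have -> : 2 * d x * d1 x + 2 * d1 x * d2 x =
     2 * d x * d1 x + pot tau' lam' x * (2 * d x * d1 x)
     + 2 * d1 x * ((pot tau' lam' x - pot tau lam x) * phi tau lam x)
     - 2 / x * d1 x ^+ 2.
    by rewrite /d2 !ddphiE// /d1 /d; ring.
  have g1 := le_trans (ler_norm _) (norm_mul2_le_sqrD (d x) (d1 x)).
  have g2 : pot tau' lam' x * (2 * d x * d1 x) <= B * E x.
    by rewrite (le_trans (ler_norm _))// normrM ler_pM// norm_mul2_le_sqrD.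
  have g3 := le_trans (ler_norm _) (norm_mul2_le_sqrD (d1 x) ((pot tau' lam' x - pot tau lam x) * phi tau lam x)).
  have g4 : ((pot tau' lam' x - pot tau lam x) * phi tau lam x) ^+ 2 <= D.
    rewrite -[leLHS]ger0_norm ?sqr_ge0// normrX; apply: lerXn2r; rewrite ?nnegrE//.
    by rewrite normrM ler_pM// hM.
  have g5 : 0 <= 2 / x * d1 x ^+ 2 by rewrite mulr_ge0 ?sqr_ge0// divr_ge0// ltW.
  have g6 : d1 x ^+ 2 <= E x by rewrite /E lerDr sqr_ge0.
  have -> : K * E x = E x + B * E x + E x by rewrite /K; ring.
  rewrite {1}/E; clear - g1 g2 g3 g4 g5 g6; lra.
have Er : E r <= e ^+ 2.
  case/andP: rb => r0 rb.
  have := @gronwall _ E _ K D 0 r r0 K0 (fun x _ => dE x).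
  have h x : 0 < x <= r -> 2 * d x * d1 x + 2 * d1 x * d2 x <= K * E x + D.
    by move=> /andP[x0 xr]; apply: EK; rewrite x0 (le_trans xr).
  move=> /(_ h); rewrite E0 add0r subr0 => h1.
  have DK : 0 <= D / K by rewrite divr_ge0 ?(ltW K0).
  apply: (@le_trans _ _ (D / K * expR (K * r))); first by clear - h1 DK; lra.
  apply: (@le_trans _ _ (D * expR (K * b) ^+ 2)).
    apply: ler_pM; rewrite ?expR_ge0//.
      by rewrite ler_pdivrMr// ler_peMr.
    rewrite (le_trans (_ : _ <= expR (K * b)))//; first by rewrite ler_expR ler_pM2l.
    by rewrite expr2 ler_peMr ?(ltW X0).
  rewrite /D -exprMn /del (_ : e / Q * L * M * expR (K * b) = e)//.
  by rewrite /Q; field; rewrite !gt_eqF.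
have h1 : d r ^+ 2 <= e ^+ 2 by apply: le_trans Er; rewrite lerDl sqr_ge0.
have h2 : d1 r ^+ 2 <= e ^+ 2 by apply: le_trans Er; rewrite lerDr sqr_ge0.
by split; rewrite -(@ler_pXn2r _ 2) ?nnegrE ?(ltW e0)// -normrX ger0_norm ?sqr_ge0.
Qed.

End OdeFacts.

(** * Growth and decay at infinity *)
Section Dichotomy.
Variable R : realType.
Implicit Types (tau lam x r a b e s : R).

Lemma sqr_le_normr a b : a ^+ 2 <= b ^+ 2 -> `|a| <= `|b|.
Proof.
by move=> h; rewrite -(@ler_pXn2r _ 2) ?nnegrE// -!normrX !ger0_norm ?sqr_ge0.
Qed.

(** The threshold beyond which the equation is dominated by its potential. *)
Definition far tau lam r0 := 1 <= r0 /\ forall r, r0 <= r -> 1 <= pot tau lam r.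

Lemma far_exists T L : exists r0 : R, forall tau lam, `|tau| <= T -> lam <= L -> far tau lam r0.
Proof.
exists (`|T| + `|L| + 2) => tau lam tT lL; split.
  by have := normr_ge0 T; have := normr_ge0 L; lra.
move=> r hr; have h1 : `|L| + 2 <= r - tau.
  have h2 := ler_norm tau; have h3 := ler_norm T.
  lra.
have h2 := ler_norm L; have h3 := normr_ge0 L.
have h4 : (`|L| + 2) ^+ 2 <= (r - tau) ^+ 2.
  by apply: lerXn2r; rewrite ?nnegrE//; lra.
by have := sqr_ge0 `|L|; move: h4; rewrite /pot sqrrD; lra.
Qed.

(** [s = 1] or [-1] is the sign of the solution; the second condition says that
    [u e^r] is moving away from zero. *)
Definition growing tau lam s r :=
  0 < s * phi tau lam r /\ 0 < s * (dphi tau lam r + phi tau lam r).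

(** Growth is self-sustaining where the potential exceeds [1]:
    [X = s u e^r] and [Z = s r e^-r (u' + u)] form a cooperative system. *)
Lemma growing_persists tau lam r0 s a : far tau lam r0 -> r0 <= a ->
  growing tau lam s a ->
  exists2 c : R, 0 < c & forall r, a <= r -> growing tau lam s r /\ c <= s * phi tau lam r.
Proof.
move=> [r01 Vr] ra [g1 g2].
pose X r := s * phi tau lam r * expR r.
pose Z r := s * expR (- r) * (r * dphi tau lam r + r * phi tau lam r).
have pos r : a <= r -> 0 < r by move=> h; rewrite (lt_le_trans _ (le_trans r01 (le_trans ra h))).
have dX r : a <= r -> is_derive r 1 X (expR r ^+ 2 / r * Z r).
  move=> ar; have r0p := pos r ar; have h1 := phi_drv tau lam r.
  eapply drv_eq; first by rewrite /X; drv.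
  rewrite /Z /= expRN; field; rewrite !gt_eqF ?expR_gt0//.
have dZ r : a <= r -> is_derive r 1 Z (expR (- r) ^+ 2 * (r * (pot tau lam r - 1) + 1) * X r).
  move=> ar; have r0p := pos r ar; have h1 := phi_drv tau lam r.
  have h2 := rdphi_drv tau lam r.
  eapply drv_eq; first by rewrite /Z; drv.
  rewrite /X /= expRN; field; rewrite !gt_eqF ?expR_gt0//.
have Xa : 0 < X a by rewrite mulr_gt0// expR_gt0.
have Za : 0 < Z a.
  have -> : Z a = a * expR (- a) * (s * (dphi tau lam a + phi tau lam a)).
    by rewrite /Z; ring.
  by rewrite mulr_gt0// mulr_gt0 ?expR_gt0// pos.
have al0 r : a <= r -> 0 <= expR r ^+ 2 / r.
  by move=> /pos r0p; rewrite divr_ge0 ?sqr_ge0// ltW.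
have be0 r : a <= r -> 0 <= expR (- r) ^+ 2 * (r * (pot tau lam r - 1) + 1).
  move=> h; have r0p := pos r h.
  rewrite mulr_ge0 ?sqr_ge0// addr_ge0// mulr_ge0 ?(ltW r0p)// subr_ge0.
  by apply: Vr; apply: le_trans h.
have H := cooperative_increasing dX dZ al0 be0 Xa Za.
have gr r : a <= r -> growing tau lam s r.
  move=> h; have [h1 h2] := H r h; have r0p := pos r h; split.
    by move: (lt_le_trans Xa h1); rewrite pmulr_lgt0// expR_gt0.
  have := lt_le_trans Za h2.
  have -> : Z r = r * expR (- r) * (s * (dphi tau lam r + phi tau lam r)).
    by rewrite /Z; ring.
  by rewrite pmulr_rgt0// mulr_gt0 ?expR_gt0.
pose c : R := Num.min (Z a) (s * phi tau lam a).
exists c; first by rewrite lt_min Za.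
move=> r ar; split; first exact: gr.
have : (s * phi tau lam a - c) * expR a <= (s * phi tau lam r - c) * expR r.
  apply: (@drv_nondecr _ (fun x => (s * phi tau lam x - c) * expR x)
     (fun x => (s * (dphi tau lam x + phi tau lam x) - c) * expR x)) => // x /andP[ax _].
    have h1 := phi_drv tau lam x.
    by eapply drv_eq; [drv | rewrite /=; ring].
  have [_ h2] := H x ax; have r0p := pos x ax.
  rewrite mulr_ge0 ?expR_ge0// subr_ge0 (@le_trans _ _ (Z a)) ?ge_min ?lexx//.
  apply: (le_trans h2).
  have -> : Z x = x * expR (- x) * (s * (dphi tau lam x + phi tau lam x)).
    by rewrite /Z; ring.
  rewrite ler_piMl//; first by apply: ltW; case: (gr x ax).
  rewrite expRN ler_pdivrMr ?expR_gt0// mul1r.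
  by have := expR_ge1Dx x; lra.
have h0 : 0 <= (s * phi tau lam a - c) * expR a.
  by rewrite mulr_ge0 ?expR_ge0// subr_ge0 ge_min lexx orbT.
by move=> /(le_trans h0); rewrite pmulr_lge0 ?expR_gt0// subr_ge0.
Qed.

(** The absence of growth, in a form that does not depend on the sign of the
    solution. *)
Definition recessive tau lam r0 := forall r, r0 <= r ->
  phi tau lam r * (dphi tau lam r + phi tau lam r) <= 0.

Lemma recessiveW tau lam r0 r1 : r0 <= r1 -> recessive tau lam r0 -> recessive tau lam r1.
Proof. by move=> h H r hr; apply: H; apply: le_trans hr. Qed.

(** [(u e^r) ^ 2] is nonincreasing. *)
Lemma recessive_bound tau lam r0 : recessive tau lam r0 -> forall r, r0 <= r ->
  `|phi tau lam r| <= `|phi tau lam r0| * expR r0 * expR (- r).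
Proof.
move=> H r rr.
have : (phi tau lam r * expR r) ^+ 2 <= (phi tau lam r0 * expR r0) ^+ 2.
  apply: (@drv_nonincr _ (fun x => (phi tau lam x * expR x) ^+ 2)
     (fun x => 2 * expR x ^+ 2 * (phi tau lam x * (dphi tau lam x + phi tau lam x)))) => // x /andP[ax _].
    have h1 := phi_drv tau lam x.
    by eapply drv_eq; [drv | rewrite /=; ring].
  by rewrite mulr_ge0_le0 ?mulr_ge0 ?sqr_ge0// H.
move=> /sqr_le_normr; rewrite normrM (normrM (phi tau lam r0)).
rewrite (ger0_norm (expR_ge0 r)) (ger0_norm (expR_ge0 r0)) => h.
by rewrite expRN -(ler_pM2r (expR_gt0 r)) divfK ?gt_eqF ?expR_gt0.
Qed.

(** By [recessive_bound] a zero would make the solution vanish from there on. *)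
Lemma recessive_neq0 tau lam r0 : far tau lam r0 -> recessive tau lam r0 ->
  forall r, r0 <= r -> phi tau lam r != 0.
Proof.
move=> [r01 _] H r rr; apply/eqP => hr.
have z x : r <= x -> phi tau lam x = 0.
  move=> rx; have := recessive_bound (recessiveW rr H) rx.
  by rewrite hr normr0 !mul0r normr_le0 => /eqP.
have r0p : 0 < r by rewrite (lt_le_trans _ (le_trans r01 rr)).
have rr1 : r <= r + 1 by rewrite lerDl.
have [c [/andP[rc _] E]] := drv_mvt rr1 (fun x _ => phi_drv tau lam x).
apply: (@phi_nondegenerate _ tau lam c); first exact: lt_le_trans rc.
  exact: z.
by move: E; rewrite !z// subrr addrAC subrr add0r mulr1.
Qed.

(** [(r u') ^ 2] is nonincreasing, which bounds [u' (r)] by its mean value over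
    [[r - 1, r]], that is by values of [u]. *)
Lemma recessive_drv_bound tau lam r0 : far tau lam r0 -> recessive tau lam r0 ->
  forall r, r0 + 1 <= r ->
  `|dphi tau lam r| <= 2 * `|phi tau lam r0| * expR (r0 + 1) * expR (- r).
Proof.
move=> [r01 Vr] H r rr.
have r1 : 1 <= r by lra.
have r1r : r - 1 <= r by lra.
have dec x : r - 1 <= x <= r -> `|r * dphi tau lam r| <= `|x * dphi tau lam x|.
  move=> /andP[rx xr]; apply: sqr_le_normr.
  apply: (@drv_nonincr _ (fun x => (x * dphi tau lam x) ^+ 2)
     (fun x => 2 * x ^+ 2 * pot tau lam x * (phi tau lam x * dphi tau lam x))) => // y /andP[ay _].
    have h1 := rdphi_drv tau lam y.
    by eapply drv_eq; [drv | rewrite /=; ring].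
  have ry : r0 <= y by lra.
  rewrite mulr_ge0_le0//.
    by rewrite mulr_ge0 ?(le_trans ler01 (Vr y ry))// mulr_ge0 ?sqr_ge0.
  by have := H y ry; have := sqr_ge0 (phi tau lam y); rewrite mulrDr; lra.
have [c [cr E]] := drv_mvt r1r (fun x _ => phi_drv tau lam x).
have h1 : dphi tau lam c = phi tau lam r - phi tau lam (r - 1).
  by rewrite E; ring.
have b1 : `|phi tau lam (r-1)| <= `|phi tau lam r0| * expR (r0 + 1) * expR (- r).
  have h : r0 <= r - 1 by lra.
  apply: (le_trans (recessive_bound H h)).
  by rewrite -!mulrA ler_wpM2l// -!expRD ler_expR; lra.
have b2 : `|phi tau lam r| <= `|phi tau lam r0| * expR (r0 + 1) * expR (- r).
  have h : r0 <= r by lra.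
  apply: (le_trans (recessive_bound H h)).
  by rewrite -!mulrA ler_wpM2l// -!expRD ler_expR; lra.
have rp : 0 < r by lra.
rewrite -(ler_pM2l rp) -{1}(gtr0_norm rp) -normrM.
apply: (le_trans (dec c cr)); case/andP: cr => c1 c2.
rewrite normrM ger0_norm; last by lra.
apply: ler_pM => //; first by lra.
rewrite h1; apply: (le_trans (ler_normB _ _)).
by apply: (le_trans (lerD b2 b1)); rewrite -mulr2n mulr_natl -!mulrnAl; lra.
Qed.

Definition decaying tau lam := exists C : R, forall r, 0 <= r ->
  `|phi tau lam r| <= C * expR (- r) /\ `|dphi tau lam r| <= C * expR (- r).

Lemma bounded_decay (f : R -> R) b A : continuous f ->
  (forall r, b <= r -> `|f r| <= A * expR (- r)) ->
  exists C : R, 0 <= C /\ forall r, 0 <= r -> `|f r| <= C * expR (- r).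
Proof.
move=> cf hA; have [M M0 hM] := segment_bounded b cf.
exists (M * expR b + `|A|); split.
  by rewrite addr_ge0 ?mulr_ge0 ?expR_ge0 ?(ltW M0).
move=> r r0; have [br|rb] := leP b r.
  apply: (le_trans (hA r br)); rewrite ler_wpM2r ?expR_ge0//.
  by rewrite ler_wpDl ?ler_norm// mulr_ge0 ?expR_ge0 ?(ltW M0).
apply: (@le_trans _ _ M); first by apply: hM; rewrite r0 ltW.
rewrite mulrDl -mulrA -expRD ler_wpDr ?mulr_ge0 ?expR_ge0//.
rewrite ler_peMr ?(ltW M0)// -expR0 ler_expR; lra.
Qed.

Lemma recessive_decaying tau lam r0 : far tau lam r0 -> recessive tau lam r0 ->
  decaying tau lam.
Proof.
move=> F H.
have [C1 [C10 h1]] := bounded_decay (@phi_cont _ tau lam) (recessive_bound H).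
have [C2 [C20 h2]] := bounded_decay (@dphi_cont _ tau lam) (recessive_drv_bound F H).
exists (C1 + C2) => r r0p; split.
  by rewrite (le_trans (h1 _ _))// ler_wpM2r ?expR_ge0// lerDl.
by rewrite (le_trans (h2 _ _))// ler_wpM2r ?expR_ge0// lerDr.
Qed.

Lemma not_recessive_growing tau lam r0 : ~ recessive tau lam r0 ->
  exists2 r, r0 <= r & growing tau lam 1 r \/ growing tau lam (-1) r.
Proof.
move=> /existsNP[r /not_implyP[rr /negP]]; rewrite -ltNge => h.
exists r => //; rewrite /growing !mul1r !mulN1r !oppr_gt0.
have [h1|h1|h1] := ltgtP 0 (phi tau lam r).
- by left; split=> //; move: h; rewrite pmulr_rgt0.
- by right; split=> //; move: h; rewrite nmulr_rgt0.
- by move: h; rewrite -h1 mul0r ltxx.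
Qed.

Lemma expR_small e C : 0 < e -> 0 <= C -> exists2 b : R, 0 <= b & forall r, b <= r -> C * expR (- r) < e.
Proof.
move=> e0 C0; exists (C / e); first by rewrite divr_ge0// ltW.
move=> r h; rewrite expRN ltr_pdivrMr ?expR_gt0//.
have : C <= e * r by rewrite mulrC -ler_pdivrMr.
move=> /le_lt_trans; apply; rewrite ltr_pM2l//.
by have := expR_ge1Dx r; lra.
Qed.

Lemma growing_not_decaying tau lam r0 s r : `|s| = 1 -> far tau lam r0 -> r0 <= r ->
  growing tau lam s r -> ~ decaying tau lam.
Proof.
move=> s1 F rr G [C hC]; have [c c0 H] := growing_persists F rr G.
have C0 : 0 <= C.
  by have [h _] := hC 0 (lexx _); move: h; rewrite oppr0 expR0 mulr1; apply: le_trans.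
have [b b0 hb] := expR_small c0 C0.
have r0p : 0 <= r by case: F => h _; lra.
pose x := r + b; have rx : r <= x by rewrite /x; lra.
have [_ h1] := H x rx; have [//|h2 _] := hC x _; first by rewrite /x; lra.
have h3 := hb x; have [_ h4] := (I, ler_norm (s * phi tau lam x)).
rewrite normrM s1 mul1r in h4.
have : b <= x by rewrite /x; lra.
move=> /h3; lra.
Qed.

Lemma decayingP tau lam r0 : far tau lam r0 -> decaying tau lam <-> recessive tau lam r0.
Proof.
move=> F; split; last exact: recessive_decaying.
move=> D; apply: contrapT => /not_recessive_growing[r rr [] G];
  by apply: growing_not_decaying F rr G D; rewrite ?normrN normr1.
Qed.

Lemma growing_sign_excl tau lam r0 a b : far tau lam r0 -> r0 <= a -> r0 <= b ->
  growing tau lam 1 a -> growing tau lam (-1) b -> False.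
Proof.
move=> F ra rb Ga Gb.
have [c c0 H] := growing_persists F ra Ga.
have [d d0 H'] := growing_persists F rb Gb.
have [|_ h1] := H (Num.max a b); first by rewrite le_max lexx.
have [|_ h2] := H' (Num.max a b); first by rewrite le_max lexx orbT.
lra.
Qed.

End Dichotomy.

(** * Shooting in the spectral parameter *)
Section Shooting.
Variable R : realType.
Implicit Types (tau lam mu x r a b e s : R).

(** The factor [r] removes the first-order term of the equation: the derivative
    is [(lam2 - lam1) r phi1 phi2]. *)
Definition wronskian tau lam1 lam2 r : R :=
  r * dphi tau lam1 r * phi tau lam2 r - phi tau lam1 r * (r * dphi tau lam2 r).

Lemma wronskian_drv tau lam1 lam2 r : is_derive r 1 (wronskian tau lam1 lam2)
  ((lam2 - lam1) * r * phi tau lam1 r * phi tau lam2 r).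
Proof.
have h1 := phi_drv tau lam1 r; have h2 := phi_drv tau lam2 r.
have h3 := rdphi_drv tau lam1 r; have h4 := rdphi_drv tau lam2 r.
by eapply drv_eq; [rewrite /wronskian; drv | rewrite /pot /=; ring].
Qed.

Lemma wronskian0 tau lam1 lam2 : wronskian tau lam1 lam2 0 = 0.
Proof. by rewrite /wronskian !mul0r mulr0 subrr. Qed.

Lemma mulr_expRN_le1 x : 0 <= x -> x * expR (- x) <= 1.
Proof.
by move=> x0; rewrite expRN ler_pdivrMr ?expR_gt0// mul1r; have := expR_ge1Dx x; lra.
Qed.

Lemma decaying_prod_small (f g : R -> R) C D e : 0 < e -> 
  (forall r, 0 <= r -> `|f r| <= C * expR (- r)) ->
  (forall r, 0 <= r -> `|g r| <= D * expR (- r)) ->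
  exists2 b : R, 0 <= b & forall r, b <= r -> `|r * f r * g r| < e.
Proof.
move=> e0 hf hg.
have C0 : 0 <= C by have := hf 0 (lexx _); rewrite oppr0 expR0 mulr1; apply: le_trans.
have D0 : 0 <= D by have := hg 0 (lexx _); rewrite oppr0 expR0 mulr1; apply: le_trans.
have [b b0 hb] := expR_small e0 (mulr_ge0 C0 D0).
exists b => // r br; have r0 : 0 <= r := le_trans b0 br.
apply: le_lt_trans (hb r br); rewrite !normrM (ger0_norm r0).
apply: (@le_trans _ _ (r * (C * expR (- r)) * (D * expR (- r)))).
  by rewrite ler_pM ?mulr_ge0// ?hg// ler_wpM2l// hf.
rewrite (_ : _ * _ = (r * expR (- r)) * (C * D * expR (- r))); last by ring.
by rewrite ler_piMl ?mulr_expRN_le1// !mulr_ge0 ?expR_ge0.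
Qed.

Lemma nonzero_sign (f : R -> R) a s : continuous f ->
  (forall r, a <= r -> f r != 0) -> 0 < s * f a -> forall r, a <= r -> 0 < s * f r.
Proof.
move=> cf f0 fa r ar; rewrite ltNge; apply/negP => fr.
have [||c] := @IVT R (fun x => s * f x) a r 0 ar.
- apply: continuous_subspaceT => x; apply: cvgM; [exact: cvg_cst | exact: cf].
- by rewrite ge_min le_max fr (ltW fa) orbT.
rewrite in_itv/= => /andP[ac _] /eqP; rewrite mulf_eq0 (negPf (f0 c ac)) orbF.
by move=> /eqP s0; rewrite s0 mul0r ltxx in fa.
Qed.

Definition sign s := s = 1 \/ s = -1.

Lemma sign_norm s : sign s -> `|s| = 1.
Proof. by case=> ->; rewrite ?normrN normr1. Qed.

Lemma sign_exists x : x != 0 -> exists s, sign s /\ 0 < s * x.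
Proof.
move=> x0; have [h|h] := ltP 0 x; first by exists 1; split; [left|rewrite mul1r].
exists (-1); split; [by right|by rewrite mulN1r oppr_gt0 lt_neqAle x0].
Qed.

(** The Wronskian at [r0] is [(lam2 - lam1)] times the integral of
    [r phi1 phi2] over [[0, r0]], which is close to that of [r phi ^ 2] and thus
    positive.  A lower bound for the latter comes from [[0, rho]], where
    [phi >= 1 / 2]. *)
Lemma wronskian_gt0 tau lam r0 : 1 <= r0 -> phi tau lam r0 != 0 ->
  exists s (delta : R), [/\ sign s, 0 < delta & forall tau' lam1 lam2,
   `|tau' - tau| < delta -> `|lam1 - lam| < delta -> `|lam2 - lam| < delta ->
   [/\ 0 < s * phi tau' lam1 r0, 0 < s * phi tau' lam2 r0 &
     lam1 < lam2 -> 0 < wronskian tau' lam1 lam2 r0]].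
Proof.
move=> r01 n0; have [s [ss sp]] := sign_exists n0.
have r00 : 0 < r0 by rewrite (lt_le_trans _ r01).
have [rho' rho'0 hrho'] := phi_near0 tau lam.
pose rho : R := Num.min rho' r0.
have rho0 : 0 < rho by rewrite lt_min rho'0.
have hrho r : 0 <= r <= rho -> 1 / 2 <= phi tau lam r.
  move=> /andP[h1 h2]; apply: hrho'; rewrite h1 (le_trans h2)//.
  by rewrite ge_min lexx.
have rhor : rho <= r0 by rewrite ge_min lexx orbT.
have [M M0 hM] := segment_bounded r0 (@phi_cont _ tau lam).
(* The error k made on phi1 phi2 costs k r0 ^ 2 / 2 = rho ^ 2 / 32, while
   [0, rho] contributes about rho ^ 2 / 8. *)
pose k : R := rho ^+ 2 / (16 * r0 ^+ 2).
have r02 : 0 < 16 * r0 ^+ 2 by rewrite mulr_gt0// exprn_gt0.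
have k0 : 0 < k by apply: divr_gt0 => //; rewrite exprn_gt0.
have k1 : k <= 1 / 16.
  rewrite ler_pdivrMr// (_ : 1 / 16 * (16 * r0 ^+ 2) = r0 ^+ 2); last by field.
  by apply: lerXn2r => //; rewrite nnegrE ltW.
have M1 : 0 < 2 * M + 1 by lra.
pose eta0 : R := Num.min 1 (k / (2 * M + 1)).
have sp2 : 0 < `|phi tau lam r0| / 2 by rewrite divr_gt0// normr_gt0.
pose eta : R := Num.min eta0 (`|phi tau lam r0| / 2).
have eta_gt0 : 0 < eta by rewrite !lt_min ltr01 sp2 divr_gt0.
have eta1 : eta <= 1 by rewrite !ge_min lexx.
have etaphi : eta <= `|phi tau lam r0| / 2 by rewrite !ge_min lexx !orbT.
have etak : (2 * M + 1) * eta <= k.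
  by rewrite mulrC -ler_pdivlMr// !ge_min lexx !orbT.
have [delta delta0 H] := phi_param_cont tau lam r0 eta_gt0.
exists s, delta; split=> // tau' lam1 lam2 ht h1 h2.
have H1 := H _ _ ht h1; have H2 := H _ _ ht h2.
have sgn lam' : `|phi tau' lam' r0 - phi tau lam r0| <= eta -> 0 < s * phi tau' lam' r0.
  move=> h; have : `|s * (phi tau' lam' r0 - phi tau lam r0)| <= eta.
    by rewrite normrM sign_norm// mul1r.
  have E : `|phi tau lam r0| = s * phi tau lam r0.
    by rewrite -[LHS]mul1r -(sign_norm ss) -normrM gtr0_norm.
  rewrite E in etaphi; rewrite ler_norml mulrBr => /andP[h3 h4]; clear - sp etaphi h3 h4; lra.
have r0r : 0 <= r0 <= r0 by rewrite lexx ltW.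
split; [by apply: sgn; case: (H1 _ r0r) | by apply: sgn; case: (H2 _ r0r) |].
move=> l12; have dl : 0 < lam2 - lam1 by rewrite subr_gt0.
have low r : 0 <= r <= r0 -> phi tau lam r ^+ 2 - k <= phi tau' lam1 r * phi tau' lam2 r.
  move=> rr; have [g1 _] := H1 r rr; have [g2 _] := H2 r rr; have gM := hM r rr.
  set p := phi tau lam r in g1 g2 gM *.
  set d1 := phi tau' lam1 r - p in g1; set d2 := phi tau' lam2 r - p in g2.
  have -> : phi tau' lam1 r * phi tau' lam2 r = p ^+ 2 + (p * (d1 + d2) + d1 * d2).
    by rewrite /d1 /d2; ring.
  rewrite lerD2l.
  have : `|p * (d1 + d2) + d1 * d2| <= (2 * M + 1) * eta.
    rewrite (le_trans (ler_normD _ _))//.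
    rewrite (_ : (2 * M + 1) * eta = M * (eta + eta) + eta * 1); last by ring.
    rewrite !normrM lerD// ler_pM// ?(le_trans g2)//.
    by rewrite (le_trans (ler_normD _ _))// lerD.
  by rewrite ler_norml => /andP[g _]; clear - g etak; lra.
set W := wronskian tau' lam1 lam2.
have Wrho : (lam2 - lam1) * (1 / 4 - k) / 2 * rho ^+ 2 <= W rho.
  rewrite -subr_ge0.
  have : W 0 - (lam2 - lam1) * (1 / 4 - k) / 2 * 0 ^+ 2 <= W rho - (lam2 - lam1) * (1 / 4 - k) / 2 * rho ^+ 2.
    apply: (@drv_nondecr _ (fun x => W x - (lam2 - lam1) * (1 / 4 - k) / 2 * x ^+ 2)
      (fun x => (lam2 - lam1) * x * (phi tau' lam1 x * phi tau' lam2 x - (1 / 4 - k)))).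
    - exact: ltW.
    - move=> x _; have h := wronskian_drv tau' lam1 lam2 x.
      by eapply drv_eq; [rewrite /W; drv | rewrite /=; field].
    - move=> x /andP[x0 xr]; have xr0 : 0 <= x <= r0 by rewrite x0 /=; exact: le_trans rhor.
      rewrite !mulr_ge0// ?(ltW dl)// subr_ge0 (le_trans _ (low x xr0))// lerD2r.
      have : 1 / 2 <= phi tau lam x by apply: hrho; rewrite x0.
      move=> hp; rewrite (_ : 1 / 4 = (1 / 2) ^+ 2); last by field.
      by apply: lerXn2r; rewrite ?nnegrE//; clear - hp; lra.
  by rewrite /W wronskian0 expr0n mulr0 subrr.
have Wr0 : W rho + (lam2 - lam1) * k / 2 * rho ^+ 2 <= W r0 + (lam2 - lam1) * k / 2 * r0 ^+ 2.
  apply: (@drv_nondecr _ (fun x => W x + (lam2 - lam1) * k / 2 * x ^+ 2)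
    (fun x => (lam2 - lam1) * x * (phi tau' lam1 x * phi tau' lam2 x + k))) => //.
  - move=> x _; have h := wronskian_drv tau' lam1 lam2 x.
    by eapply drv_eq; [rewrite /W; drv | rewrite /=; field].
  - move=> x /andP[xr xr0]; have x0 := le_trans (ltW rho0) xr.
    rewrite !mulr_ge0// ?(ltW dl)//.
    have := low x; rewrite x0 xr0 => /(_ isT) g1; have g2 := sqr_ge0 (phi tau lam x).
    by clear - g1 g2; lra.
have kr : k * r0 ^+ 2 = rho ^+ 2 / 16 by rewrite /k; field; rewrite gt_eqF.
have : 0 < (lam2 - lam1) * rho ^+ 2 by rewrite mulr_gt0// exprn_gt0.
set A := (lam2 - lam1) * rho ^+ 2 => A0.
have e1 : (lam2 - lam1) * (1 / 4 - k) / 2 * rho ^+ 2 = A / 8 - A * k / 2.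
  by rewrite /A; field.
have e2 : (lam2 - lam1) * k / 2 * r0 ^+ 2 = A / 32.
  rewrite (_ : _ * _ = (lam2 - lam1) / 2 * (k * r0 ^+ 2)); last by ring.
  by rewrite kr /A; field.
have e3 : (lam2 - lam1) * k / 2 * rho ^+ 2 = A * k / 2 by rewrite /A; ring.
by rewrite e1 in Wrho; rewrite e2 e3 in Wr0; clear - Wrho Wr0 A0; lra.
Qed.

Lemma far_near tau lam : exists r0 : R, forall tau' lam',
  `|tau' - tau| < 1 -> `|lam' - lam| < 1 -> far tau' lam' r0.
Proof.
have [r0 H] := far_exists (`|tau| + 1) (lam + 1); exists r0 => tau' lam' ht hl.
apply: H; last by have := ler_norm (lam' - lam); lra.
by rewrite -[tau'](subrK tau) (le_trans (ler_normD _ _))// addrC lerD2l ltW.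
Qed.

Lemma growing_open tau lam s r : sign s -> 0 <= r -> growing tau lam s r ->
  exists2 delta : R, 0 < delta & forall tau' lam',
  `|tau' - tau| < delta -> `|lam' - lam| < delta -> growing tau' lam' s r.
Proof.
move=> ss r0 [g1 g2].
pose e : R := Num.min (s * phi tau lam r / 2) (s * (dphi tau lam r + phi tau lam r) / 3).
have e0 : 0 < e by rewrite lt_min !divr_gt0.
have e1 : e <= s * phi tau lam r / 2 by rewrite ge_min lexx.
have e2 : e <= s * (dphi tau lam r + phi tau lam r) / 3 by rewrite ge_min lexx orbT.
have [d d0 H] := phi_param_cont tau lam r e0; exists d => // tau' lam' ht hl.
have [|h1 h2] := H _ _ ht hl r; first by rewrite r0 lexx.
have k1 : `|s * (phi tau' lam' r - phi tau lam r)| <= e by rewrite normrM sign_norm// mul1r.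
have k2 : `|s * (dphi tau' lam' r - dphi tau lam r)| <= e by rewrite normrM sign_norm// mul1r.
move: k1 k2; rewrite !ler_norml !mulrBr => /andP[k1 _] /andP[k2 _].
split; first by clear - k1 e0 e1; lra.
by rewrite mulrDr; rewrite mulrDr in e2; clear - k1 k2 e0 e2; lra.
Qed.

Lemma not_decaying_growing tau lam r0 : far tau lam r0 -> ~ decaying tau lam ->
  exists s r, [/\ sign s, r0 <= r & growing tau lam s r].
Proof.
move=> F; rewrite (decayingP F) => /not_recessive_growing[r rr [] G].
  by exists 1, r; split=> //; left.
by exists (-1), r; split=> //; right.
Qed.

Lemma growing_excl tau lam r0 s a b : sign s -> far tau lam r0 -> r0 <= a -> r0 <= b ->
  growing tau lam s a -> growing tau lam (- s) b -> False.
Proof.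
move=> [] -> F ra rb; rewrite ?opprK => G1 G2.
  exact: growing_sign_excl F ra rb G1 G2.
exact: growing_sign_excl F rb ra G2 G1.
Qed.

Lemma not_decaying_open tau lam : ~ decaying tau lam ->
  exists2 delta : R, 0 < delta & forall tau' lam',
  `|tau' - tau| < delta -> `|lam' - lam| < delta -> ~ decaying tau' lam'.
Proof.
move=> nd; have [r0 F] := far_near tau lam.
have F0 : far tau lam r0 by apply: F; rewrite subrr normr0.
have [s [r [ss rr G]]] := not_decaying_growing F0 nd.
have rp : 0 <= r by case: F0 => h _; lra.
have [d d0 H] := growing_open ss rp G.
exists (Num.min 1 d); first by rewrite lt_min ltr01.
move=> tau' lam'; rewrite !lt_min => /andP[t1 t2] /andP[l1 l2].
exact: growing_not_decaying (sign_norm ss) (F _ _ t1 l1) rr (H _ _ t2 l2).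
Qed.

Lemma wronskianC tau lam1 lam2 r :
  wronskian tau lam1 lam2 r = - wronskian tau lam2 lam1 r.
Proof. by rewrite /wronskian; ring. Qed.

Lemma ratio_drv tau mu lam x : 0 < x -> phi tau lam x != 0 ->
  is_derive x 1 (fun y => phi tau mu y / phi tau lam y)
    ((x * phi tau lam x ^+ 2)^-1 * wronskian tau mu lam x).
Proof.
move=> x0 n0; have h1 := phi_drv tau mu x; have h2 := is_deriveV n0 (phi_drv tau lam x).
eapply drv_eq; first by drv.
by rewrite /wronskian /GRing.scale /=; field; rewrite n0 gt_eqF.
Qed.

Lemma prod_div_gt0 x y : 0 < x * y -> 0 < x / y.
Proof.
move=> h; have y0 : y != 0 by apply/eqP => E; rewrite E mulr0 ltxx in h.
rewrite (_ : x / y = x * y / y ^+ 2); last by field.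
by rewrite divr_gt0// exprn_even_gt0.
Qed.

Lemma sign_inj s s' x : sign s -> sign s' -> 0 < s * x -> 0 < s' * x -> s = s'.
Proof. by move=> [] -> [] ->; rewrite ?mul1r ?mulN1r ?oppr_gt0 //; lra. Qed.

(** In this section [(tau, lam)] is the parameter of a decaying solution and
    [delta] a radius provided by [wronskian_gt0]. *)
Section AroundDecaying.
Variables (tau lam r0 s delta : R).
Hypothesis dlam : decaying tau lam.
Hypothesis F : forall tau' lam', `|tau' - tau| < delta -> `|lam' - lam| < delta ->
  far tau' lam' r0.
Hypothesis ss : sign s.
Hypothesis delta0 : 0 < delta.
Hypothesis W0 : forall tau' lam1 lam2,
   `|tau' - tau| < delta -> `|lam1 - lam| < delta -> `|lam2 - lam| < delta ->
   [/\ 0 < s * phi tau' lam1 r0, 0 < s * phi tau' lam2 r0 &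
     lam1 < lam2 -> 0 < wronskian tau' lam1 lam2 r0].

Let r00 : 0 < r0.
Proof.
have [h _] : far tau lam r0 by apply: F; rewrite subrr normr0.
by lra.
Qed.

Let sgn_decaying tau' lam' : `|tau' - tau| < delta -> `|lam' - lam| < delta ->
  decaying tau' lam' -> forall r, r0 <= r -> 0 < s * phi tau' lam' r.
Proof.
move=> ht hl D; apply: nonzero_sign; first exact: phi_cont.
  have FF := F ht hl.
  exact: recessive_neq0 FF (proj1 (decayingP FF) D).
by have [] := W0 ht hl hl.
Qed.

Let prod_pos x y : 0 < s * x -> 0 < s * y -> 0 < x * y.
Proof.
have s2 : s * s = 1 by case: ss => ->; rewrite ?mulrNN mulr1.
by move=> hx hy; have := mulr_gt0 hx hy; rewrite mulrACA s2 mul1r.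
Qed.

(** Beyond [r0] decaying solutions keep their sign, so that the Wronskian goes
    on increasing from a positive value: it cannot tend to [0]. *)
Lemma decaying_unique tau' lam1 lam2 :
   `|tau' - tau| < delta -> `|lam1 - lam| < delta -> `|lam2 - lam| < delta ->
  decaying tau' lam1 -> decaying tau' lam2 -> lam1 < lam2 -> False.
Proof.
move=> ht h1 h2 D1 D2 l12; have [_ _ /(_ l12) Wp] := W0 ht h1 h2.
have [C1 H1] := D1; have [C2 H2] := D2.
have Wp2 : 0 < wronskian tau' lam1 lam2 r0 / 2 by rewrite divr_gt0.
have [b b0 hb] := decaying_prod_small Wp2 (fun r h => (H1 r h).2) (fun r h => (H2 r h).1).
have [c c0 hc] := decaying_prod_small Wp2 (fun r h => (H1 r h).1) (fun r h => (H2 r h).2).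
pose r : R := Num.max r0 (Num.max b c).
have [rr [br cr]] : r0 <= r /\ b <= r /\ c <= r.
  by rewrite /r !le_max !lexx !orbT.
have : wronskian tau' lam1 lam2 r0 <= wronskian tau' lam1 lam2 r.
  apply: drv_nondecr rr (fun x _ => wronskian_drv tau' lam1 lam2 x) _ => x /andP[rx _].
  have x0 : 0 <= x by apply: le_trans rx; apply: ltW.
  rewrite -mulrA mulr_ge0//; first by rewrite mulr_ge0 ?subr_ge0 ?(ltW l12).
  by apply: ltW; apply: prod_pos; [apply: (sgn_decaying ht h1 D1) | apply: (sgn_decaying ht h2 D2)].
have := hb r br; have := hc r cr; rewrite !ltr_norml => /andP[g1 g2] /andP[g3 g4].
rewrite {2}/wronskian (_ : phi tau' lam1 r * _ = r * phi tau' lam1 r * dphi tau' lam2 r); last by ring.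
by lra.
Qed.

(** The ratio [phi_mu / phi_lam] and the Wronskian form a cooperative system,
    so that [phi_mu] keeps the sign of [phi_lam]. *)
Lemma growing_left mu : `|mu - lam| < delta -> mu < lam ->
  exists2 r, r0 <= r & growing tau mu s r.
Proof.
move=> hm ml; have ht : `|tau - tau| < delta by rewrite subrr normr0.
have hl : `|lam - lam| < delta by rewrite subrr normr0.
have nd : ~ decaying tau mu by move=> D; exact: decaying_unique ht hm hl D dlam ml.
have [s' [r [ss' rr G]]] := not_decaying_growing (F ht hm) nd.
have [p1 p2 /(_ ml) Wp] := W0 ht hm hl.
have lp := sgn_decaying ht hl dlam.
have ln x : r0 <= x -> phi tau lam x != 0.
  by move=> /lp h; apply/eqP => E; rewrite E mulr0 ltxx in h.
have ld x : r0 <= x -> is_derive x 1 (fun y => phi tau mu y / phi tau lam y)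
    ((x * phi tau lam x ^+ 2)^-1 * wronskian tau mu lam x).
  move=> rx; apply: ratio_drv; [exact: lt_le_trans rx | exact: ln].
have wd x : r0 <= x -> is_derive x 1 (wronskian tau mu lam)
    ((lam - mu) * x * phi tau lam x ^+ 2 * (phi tau mu x / phi tau lam x)).
  move=> rx; apply: drv_eq; first exact: wronskian_drv.
  by field; exact: ln.
have rat0 : 0 < phi tau mu r0 / phi tau lam r0.
  by apply: prod_div_gt0; exact: prod_pos.
have sp x : r0 <= x -> 0 < s * phi tau mu x.
  move=> rx.
  have [||h _] := cooperative_increasing ld wd _ _ rat0 Wp rx.
  - by move=> y ry; rewrite invr_ge0 mulr_ge0 ?sqr_ge0// ltW// (lt_le_trans r00).
  - move=> y ry; rewrite mulr_ge0 ?sqr_ge0// mulr_ge0 ?subr_ge0 ?(ltW ml)//.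
    by rewrite ltW// (lt_le_trans r00).
  have -> : s * phi tau mu x = phi tau mu x / phi tau lam x * (s * phi tau lam x).
    by field; exact: ln.
  by rewrite mulr_gt0 ?lp// (lt_le_trans rat0).
exists r => //; rewrite (sign_inj ss ss' (sp r rr))//; by case: G.
Qed.

(** If [phi_mu] grew with the sign of [phi_lam], it would keep this sign by
    [barrier_ge0]; then the Wronskian stays positive, [phi_mu / phi_lam]
    decreases, and [phi_mu] decays. *)
Lemma growing_right mu : `|mu - lam| < delta -> lam < mu ->
  exists2 r, r0 <= r & growing tau mu (- s) r.
Proof.
move=> hm lm; have ht : `|tau - tau| < delta by rewrite subrr normr0.
have hl : `|lam - lam| < delta by rewrite subrr normr0.
have nd : ~ decaying tau mu by move=> D; exact: decaying_unique ht hl hm dlam D lm.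
have [s' [r [ss' rr G]]] := not_decaying_growing (F ht hm) nd.
have [p1 p2 /(_ lm) Wp] := W0 ht hl hm.
have lp := sgn_decaying ht hl dlam.
have ln x : r0 <= x -> phi tau lam x != 0.
  by move=> /lp h; apply/eqP => E; rewrite E mulr0 ltxx in h.
have [E|] := boolP (s' == - s); first by exists r => //; rewrite -(eqP E).
move=> ne; have {ne} E : s' = s.
  by case: ss ss' ne => -> [] ->; rewrite ?opprK ?eqxx.
rewrite {s' ss'}E in G; apply: contrapT => nG.
have [c c0 H] := growing_persists (F ht hm) rr G.
have m0 x : r0 <= x -> 0 <= s * phi tau mu x.
  move=> rx; have : 0 <= s * phi tau mu x * expR x.
    apply: (@barrier_ge0 _ (fun x => s * phi tau mu x * expR x)
      (fun x => s * (dphi tau mu x + phi tau mu x) * expR x)) rx _ _ _ => [y _||y /andP[ry _]].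
    - by have h := phi_drv tau mu y; eapply drv_eq; [drv | rewrite /=; ring].
    - by rewrite mulr_ge0 ?expR_ge0// ltW.
    - rewrite pmulr_llt0 ?expR_gt0// => h.
      rewrite mulr_ge0 ?expR_ge0// leNgt; apply/negP => h'; apply: nG.
      by exists y => //; split; rewrite mulNr oppr_gt0.
  by rewrite pmulr_lge0 ?expR_gt0.
have Wx x : r0 <= x -> 0 <= wronskian tau lam mu x.
  move=> rx; apply: (le_trans (ltW Wp)).
  apply: drv_nondecr rx (fun x _ => wronskian_drv tau lam mu x) _ => y /andP[ry _].
  rewrite -mulrA mulr_ge0//.
    by rewrite mulr_ge0 ?subr_ge0 ?(ltW lm)// ltW// (lt_le_trans r00).
  have := mulr_ge0 (ltW (lp y ry)) (m0 y ry).
  by rewrite mulrACA; case: ss => ->; rewrite ?mulrNN mulr1 mul1r.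
set q := phi tau mu r0 / phi tau lam r0.
have up x : r0 <= x -> s * phi tau mu x <= q * (s * phi tau lam x).
  move=> rx; have : phi tau mu x / phi tau lam x <= q.
    apply: (@drv_nonincr _ (fun y => phi tau mu y / phi tau lam y)
      (fun x => (x * phi tau lam x ^+ 2)^-1 * wronskian tau mu lam x)) => // y /andP[ry _].
      by apply: ratio_drv; [exact: lt_le_trans ry | exact: ln].
    rewrite mulr_ge0_le0//.
      by rewrite invr_ge0 mulr_ge0 ?sqr_ge0// ltW// (lt_le_trans r00).
    by rewrite wronskianC oppr_le0 Wx.
  rewrite -(ler_pM2r (lp x rx)) => h; apply: le_trans h.
  by rewrite le_eqVlt; apply/orP; left; apply/eqP; field; exact: ln.
have [C hC] := dlam.
have C0 : 0 <= `|q| * `|C| by rewrite mulr_ge0.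
have [b b0 hb] := expR_small c0 C0.
pose x : R := Num.max r b.
have rx : r <= x by rewrite le_max lexx.
have r0x := le_trans rr rx.
have bx : b <= x by rewrite le_max lexx orbT.
have x0 : 0 <= x by exact: le_trans bx.
have [_ h1] := H x rx; have h2 := hb x bx; have h3 := up x r0x.
have h4 : q * (s * phi tau lam x) <= `|q| * `|C| * expR (- x).
  rewrite (le_trans (ler_norm _))// normrM (normrM s) (sign_norm ss) mul1r -mulrA ler_wpM2l//.
  have [h _] := hC x x0; apply: (le_trans h); by rewrite ler_wpM2r ?expR_ge0// ler_norm.
by lra.
Qed.

(** At [tau], hence also at nearby [tau'], the solutions at the two ends of a
    small interval grow with opposite signs.  Where growth with the first sign
    stops, the solution can grow with neither sign, as both conditions are
    open. *)
Lemma decaying_near e : 0 < e -> exists2 d : R, 0 < d & forall tau',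
  `|tau' - tau| < d -> exists2 lam', `|lam' - lam| < e & decaying tau' lam'.
Proof.
move=> e0; pose e1 : R := Num.min e delta / 2.
have m0 : 0 < Num.min e delta by rewrite lt_min e0.
have e10 : 0 < e1 by rewrite divr_gt0.
have [e1e e1d] : e1 < e /\ e1 < delta.
  have h1 : e1 < Num.min e delta by rewrite ltr_pdivrMr// ltr_pMr// ltr1n.
  by split; apply: (lt_le_trans h1); rewrite ge_min lexx ?orbT.
have nl : `|lam - e1 - lam| < delta by rewrite addrAC subrr add0r normrN gtr0_norm.
have nr : `|lam + e1 - lam| < delta by rewrite addrAC subrr add0r gtr0_norm.
have [|rl hrl Gl] := growing_left nl; first by rewrite ltrBlDr ltrDl.
have [|rr hrr Gr] := growing_right nr; first by rewrite ltrDl.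
have ss' : sign (- s) by case: ss => ->; [right|left; rewrite opprK].
have [dl dl0 Hl] := growing_open ss (le_trans (ltW r00) hrl) Gl.
have [dr dr0 Hr] := growing_open ss' (le_trans (ltW r00) hrr) Gr.
exists (Num.min delta (Num.min dl dr)); first by rewrite !lt_min dl0 dr0 delta0.
move=> tau'; rewrite !lt_min => /and3P[ht htl htr].
have {Gl}Gl : growing tau' (lam - e1) s rl by apply: Hl; rewrite ?subrr ?normr0.
have {Gr}Gr : growing tau' (lam + e1) (- s) rr by apply: Hr; rewrite ?subrr ?normr0.
have near x : lam - e1 <= x <= lam + e1 -> `|x - lam| < delta.
  by move=> h; apply: le_lt_trans e1d; rewrite ler_distl.
pose S := [set x | lam - e1 <= x <= lam + e1 /\ exists2 r, r0 <= r & growing tau' x s r].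
have Sl : S (lam - e1).
  by split; [rewrite lexx/= lerD2l; lra | exists rl].
have hS : has_sup S by split; [exists (lam - e1) | exists (lam + e1) => x [/andP[]]].
pose m := sup S.
have ml : lam - e1 <= m by apply: (ub_le_sup hS.2).
have mr : m <= lam + e1 by apply: (ge_sup hS.1) => x [/andP[]].
have mm : lam - e1 <= m <= lam + e1 by rewrite ml mr.
exists m; first by apply: le_lt_trans e1e; rewrite ler_distl.
apply: contrapT => nd; have Fm := F ht (near _ mm).
have [s' [r [ss1 hr G]]] := not_decaying_growing Fm nd.
have [d d0 Hd] := growing_open ss1 (le_trans (ltW r00) hr) G.
have Hd' x : `|x - m| < d -> growing tau' x s' r by apply: Hd; rewrite subrr normr0.
have [E|] := boolP (s' == s).
  rewrite (eqP E) in Hd' G; move: mr; rewrite le_eqVlt => /predU1P[mE|mlt].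
    by rewrite mE in G Fm; exact: growing_excl ss Fm hr hrr G Gr.
  pose x : R := Num.min (m + d / 2) (lam + e1).
  have mx : m < x by rewrite lt_min mlt ltrDl divr_gt0.
  have xr : x <= lam + e1 by rewrite ge_min lexx orbT.
  have xd : x <= m + d / 2 by rewrite ge_min lexx.
  have : S x.
    split; first by rewrite xr andbT (le_trans ml (ltW mx)).
    by exists r => //; apply: Hd'; rewrite gtr0_norm ?subr_gt0//; clear - xd d0; lra.
  by move=> /(ub_le_sup hS.2); rewrite leNgt mx.
move=> ne; have {ne} E : s' = - s.
  by case: ss ss1 ne => -> [] ->; rewrite ?opprK ?eqxx.
rewrite E in Hd'.
have [x Sx mx] := sup_adherent d0 hS.
have xm := ub_le_sup hS.2 Sx; case: Sx => hx [r' hr' G'].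
apply: (growing_excl ss (F ht (near _ hx)) hr' hr G'); apply: Hd'.
by rewrite ler0_norm ?subr_le0//; move: mx; rewrite -/m; lra.
Qed.

End AroundDecaying.

(** Near the parameters of a decaying solution [far] and [wronskian_gt0] hold on
    a common radius, so that [decaying_unique] and [decaying_near] apply. *)
Lemma decaying_perturb tau lam : decaying tau lam -> exists delta : R, [/\ 0 < delta,
  (forall tau' lam1 lam2, `|tau' - tau| < delta -> `|lam1 - lam| < delta ->
     `|lam2 - lam| < delta -> decaying tau' lam1 -> decaying tau' lam2 -> lam1 = lam2) &
  (forall e, 0 < e -> exists2 d : R, 0 < d & forall tau', `|tau' - tau| < d ->
     exists2 lam', `|lam' - lam| < e & decaying tau' lam')].
Proof.
move=> D; have [r0 F] := far_near tau lam.
have F0 : far tau lam r0 by apply: F; rewrite subrr normr0.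
have r01 : 1 <= r0 by case: F0.
have n0 := recessive_neq0 F0 (proj1 (decayingP F0) D) (lexx r0).
have [s [d [ss d0 H]]] := wronskian_gt0 r01 n0.
pose dd : R := Num.min 1 d.
have dd0 : 0 < dd by rewrite lt_min ltr01.
have F' tau' lam' : `|tau' - tau| < dd -> `|lam' - lam| < dd -> far tau' lam' r0.
  by rewrite !lt_min => /andP[h1 _] /andP[h2 _]; exact: F.
have H' tau' lam1 lam2 : `|tau' - tau| < dd -> `|lam1 - lam| < dd -> `|lam2 - lam| < dd ->
   [/\ 0 < s * phi tau' lam1 r0, 0 < s * phi tau' lam2 r0 &
     lam1 < lam2 -> 0 < wronskian tau' lam1 lam2 r0].
  by rewrite !lt_min => /andP[_ h1] /andP[_ h2] /andP[_ h3]; exact: H.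
exists dd; split=> //; last first.
  move=> e e0; exact: (decaying_near D F' ss dd0 H' e0).
move=> tau' l1 l2 ht h1 h2 D1 D2; have [l12|l12|//] := ltgtP l1 l2; exfalso.
  exact: (decaying_unique F' ss dd0 H' ht h1 h2 D1 D2 l12).
exact: (decaying_unique F' ss dd0 H' ht h2 h1 D2 D1 l12).
Qed.

(** For [lam <= 0] the quantity [r u u'], zero at both ends, would be
    nondecreasing, and strictly so near [0]. *)
Lemma decaying_gt0 tau lam : decaying tau lam -> 0 < lam.
Proof.
move=> [C hC]; rewrite ltNge; apply/negP => l0.
pose Q r := phi tau lam r * (r * dphi tau lam r).
pose Q' r := r * dphi tau lam r ^+ 2 + r * pot tau lam r * phi tau lam r ^+ 2.
have dQ r : is_derive r 1 Q (Q' r).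
  have h1 := phi_drv tau lam r; have h2 := rdphi_drv tau lam r.
  by eapply drv_eq; [rewrite /Q; drv | rewrite /Q' /=; ring].
have V0 r : (r - tau) ^+ 2 <= pot tau lam r by rewrite /pot; lra.
have mono a b : 0 <= a -> a <= b -> Q a <= Q b.
  move=> a0 ab; apply: drv_nondecr ab (fun x _ => dQ x) _ => x /andP[ax _].
  have x0 := le_trans a0 ax.
  have Vp := le_trans (sqr_ge0 _) (V0 x).
  by rewrite addr_ge0// mulr_ge0 ?sqr_ge0// mulr_ge0.
have Qz r : 0 <= r -> Q r = 0.
  move=> r0; apply/eqP; rewrite eq_le; apply/andP; split; last first.
    by have := mono _ _ (lexx 0) r0; rewrite {1}/Q mul0r mulr0.
  rewrite leNgt; apply/negP => Qr.
  have [b b0 hb] := decaying_prod_small Qr (fun r h => (hC r h).1) (fun r h => (hC r h).2).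
  pose x : R := Num.max r b.
  have rx : r <= x by rewrite le_max lexx.
  have bx : b <= x by rewrite le_max lexx orbT.
  have := mono _ _ r0 rx; have := le_lt_trans (ler_norm _) (hb x bx).
  by rewrite -mulrA mulrCA -/(Q x); lra.
have [rho rho0 hr] := phi_near0 tau lam.
suff [a [b [ab h]]] : exists a b : R, a < b /\ forall x, a <= x <= b -> [/\ 0 < x, x <= rho & x != tau].
  have [c [/h[c0 cr ct] E]] := drv_mvt (ltW ab) (fun x _ => dQ x).
  have a0 : 0 < a by have [] := h a; rewrite ?lexx ?(ltW ab).
  have : 0 < Q' c * (b - a).
    apply: mulr_gt0; last by rewrite subr_gt0.
    apply: ltr_wpDl; first by rewrite mulr_ge0 ?sqr_ge0// ltW.
    have Vc : 0 < pot tau lam c.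
      by rewrite (lt_le_trans _ (V0 c))// exprn_even_gt0//= subr_eq0.
    have pc : 1 / 2 <= phi tau lam c by apply: hr; rewrite cr ltW.
    by apply: mulr_gt0; [apply: mulr_gt0 | apply: exprn_gt0; lra].
  by rewrite -E !Qz ?subrr ?ltxx// ltW// (lt_trans a0).
have [tr|rt] := ltP tau (5 / 8 * rho).
  exists (3 / 4 * rho), rho; split; first lra.
  by move=> x /andP[h1 h2]; split=> //; [lra | rewrite gt_eqF//; lra].
exists (1 / 4 * rho), (1 / 2 * rho); split; first lra.
by move=> x /andP[h1 h2]; split=> //; [lra | lra | rewrite lt_eqF//; lra].
Qed.

End Shooting.

(** * Exponentially decaying functions on the half-line *)
Section ExponentialDecay.
Variable R : realType.
Implicit Types (f g F : R -> R) (x r a b e k C : R).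
Local Notation mu := (@lebesgue_measure R).

(** The rate is left free, which makes the class stable under sums of functions
    with different rates and under multiplication by polynomials. *)
Definition edecay g := exists k C : R, [/\ 0 < k, 0 <= C &
  forall r, 0 <= r -> `|g r| <= C * expR (- (k * r))].

Lemma edecayD f g : edecay f -> edecay g -> edecay (fun r => f r + g r).
Proof.
move=> [k [C [k0 C0 hf]]] [l [D [l0 D0 hg]]].
exists (Num.min k l), (C + D); split; rewrite ?lt_min ?k0 ?addr_ge0// => r r0.
rewrite (le_trans (ler_normD _ _))// mulrDl lerD//.
  by rewrite (le_trans (hf r r0))// ler_wpM2l// ler_expR lerN2 ler_wpM2r// ge_min lexx.
by rewrite (le_trans (hg r r0))// ler_wpM2l// ler_expR lerN2 ler_wpM2r// ge_min lexx orbT.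
Qed.

Lemma edecayM f g : edecay f -> edecay g -> edecay (fun r => f r * g r).
Proof.
move=> [k [C [k0 C0 hf]]] [l [D [l0 D0 hg]]].
exists (k + l), (C * D); split; rewrite ?addr_gt0 ?mulr_ge0// => r r0.
rewrite normrM mulrDl opprD expRD mulrACA ler_pM//; [exact: hf | exact: hg].
Qed.

Lemma edecayZ a f : edecay f -> edecay (fun r => a * f r).
Proof.
move=> [k [C [k0 C0 hf]]]; exists k, (`|a| * C); split; rewrite ?mulr_ge0// => r r0.
by rewrite normrM -mulrA ler_wpM2l// hf.
Qed.

Lemma edecayX f : edecay f -> edecay (fun r => r * f r).
Proof.
move=> [k [C [k0 C0 hf]]]; have k2 : 0 < k / 2 by rewrite divr_gt0.
exists (k / 2), (C / (k / 2)); split=> [//||r r0]; first by rewrite (divr_ge0 C0 (ltW k2)).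
rewrite normrM (ger0_norm r0).
apply: (@le_trans _ _ (r * (C * expR (- (k * r))))); first by rewrite ler_wpM2l// hf.
have h := mulr_expRN_le1 (mulr_ge0 (ltW k2) r0).
have -> : - (k * r) = - (k / 2 * r) + - (k / 2 * r) by field.
rewrite expRD.
have -> : r * (C * (expR (- (k / 2 * r)) * expR (- (k / 2 * r)))) =
  (k / 2 * r * expR (- (k / 2 * r))) * (C / (k / 2) * expR (- (k / 2 * r))).
  by field; rewrite gt_eqF.
by rewrite ler_piMl// mulr_ge0 ?expR_ge0// divr_ge0// ltW.
Qed.

Lemma edecay_eq f g : f =1 g -> edecay f -> edecay g.
Proof. by move=> /funext ->. Qed.

Lemma edecay_cvg f : edecay f -> f x @[x --> +oo%R] --> (0 : R).
Proof.
move=> [k [C [k0 C0 hf]]]; apply/cvgrPdist_lt => e e0.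
have [b b0 hb] := expR_small e0 C0.
near=> r; rewrite sub0r normrN.
have rb : b <= k * r.
  by rewrite mulrC -ler_pdivrMr//; near: r; apply: nbhs_pinfty_ge; exact: num_real.
apply: le_lt_trans (hb _ rb); apply: hf.
by near: r; apply: nbhs_pinfty_ge; exact: num_real.
Unshelve. all: by end_near. Qed.

Lemma continuous_measurable_on g (D : set R) : continuous g -> measurable_fun D g.
Proof. by move=> cg; apply: measurable_funTS; exact: continuous_measurable_fun. Qed.

Lemma expR_integral k C : 0 < k -> 0 <= C ->
  (\int[mu]_(x in `[0%R, +oo[) (C * expR (- (k * x)))%:E = (C / k)%:E)%E.
Proof.
move=> k0 C0; pose F x := - (C / k) * expR (- (k * x)).
have dF x : is_derive x 1 F (C * expR (- (k * x))).
  by eapply drv_eq; [rewrite /F; drv | rewrite /=; field; rewrite gt_eqF].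
have eF : edecay F.
  by apply: edecayZ; exists k, 1; split=> // r _; rewrite mul1r ger0_norm ?expR_ge0.
rewrite (@ge0_continuous_FTC2y _ _ F 0 0).
- by rewrite /F mulr0 oppr0 expR0 mulr1 sub0e -EFinN opprK.
- by move=> x _; rewrite mulr_ge0 ?expR_ge0.
- apply: continuous_subspaceT => x; apply: drv_cont (_ : is_derive x 1 _ (- k * C * expR (- (k * x)))).
  by eapply drv_eq; [drv | rewrite /=; ring].
- exact: edecay_cvg.
- by move=> x _; case: (dF x).
- by apply: cvg_at_right_filter; exact: drv_cont (dF 0).
- by move=> x _; rewrite derive1E; case: (dF x).
Qed.

Lemma expR_integrable k C : 0 < k -> 0 <= C ->
  mu.-integrable `[0%R, +oo[ (fun x => (C * expR (- (k * x)))%:E).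
Proof.
move=> k0 C0; apply/integrableP; split.
  apply/measurable_EFinP; apply: continuous_measurable_on => x.
  apply: drv_cont (_ : is_derive x 1 _ (- k * C * expR (- (k * x)))).
  by eapply drv_eq; [drv | rewrite /=; ring].
under eq_integral => x _ do rewrite gee0_abs ?lee_fin ?mulr_ge0 ?expR_ge0//.
by rewrite expR_integral// ltry.
Qed.

Lemma edecay_integrable g : continuous g -> edecay g ->
  mu.-integrable `[0%R, +oo[ (EFin \o g).
Proof.
move=> cg [k [C [k0 C0 h]]].
apply: le_integrable (expR_integrable k0 C0) => //.
- by apply/measurable_EFinP; exact: continuous_measurable_on.
- move=> x /=; rewrite in_itv/= andbT => x0.
  by rewrite lee_fin (ger0_norm (mulr_ge0 C0 (expR_ge0 _))) h.
Qed.

(** The fundamental theorem on the half-line for a signed integrand: adding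
    [C exp(- k r)] reduces it to the nonnegative case. *)
Lemma edecay_FTC F f : (forall x, is_derive x 1 F (f x)) -> continuous f ->
  edecay f -> edecay F -> (\int[mu]_(x in `[0%R, +oo[) f x = - F 0)%R.
Proof.
move=> dF cf ef eF; have [k [C [k0 C0 h]]] := ef.
pose E x := C * expR (- (k * x)).
pose G x := F x - C / k * expR (- (k * x)).
have dG x : is_derive x 1 G (f x + E x).
  have h1 := dF x.
  by eapply drv_eq; [rewrite /G; drv | rewrite /E /=; field; rewrite gt_eqF].
have cE : continuous E.
  move=> x; apply: drv_cont (_ : is_derive x 1 _ (- k * C * expR (- (k * x)))).
  by eapply drv_eq; [rewrite /E; drv | rewrite /=; ring].
have eG : edecay G.
  apply: (edecayD eF); apply: (@edecay_eq (fun r => - (C / k) * expR (- (k * r)))).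
    by move=> r; rewrite mulNr.
  by apply: edecayZ; exists k, 1; split=> // r _; rewrite mul1r ger0_norm ?expR_ge0.
have iE : mu.-integrable `[0%R, +oo[ (EFin \o E) by exact: expR_integrable.
have IE : (\int[mu]_(x in `[0%R, +oo[) E x = C / k)%R.
  by rewrite /Rintegral expR_integral.
have cG : continuous G by move=> x; exact: drv_cont (dG x).
have IG : (\int[mu]_(x in `[0%R, +oo[) (f x + E x) = 0 - G 0)%R.
  apply: (@Rintegral_ge0_continuous_FTC2y _ _ G 0 0).
  - move=> x x0; have := h x x0; rewrite ler_norml => /andP[]; rewrite /E; lra.
  - by apply: continuous_subspaceT => x; apply: cvgD; [exact: cf | exact: cE].
  - exact: edecay_cvg.
  - by move=> x _; case: (dG x).
  - by apply: cvg_at_right_filter; exact: cG.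
  - by move=> x _; rewrite derive1E; case: (dG x).
move: IG; rewrite RintegralD//; last exact: edecay_integrable.
by rewrite IE /G mulr0 oppr0 expR0 mulr1; lra.
Qed.

Lemma edecay_Rintegral_le g k C : 0 < k -> continuous g ->
  (forall r, 0 <= r -> `|g r| <= C * expR (- (k * r))) ->
  `|\int[mu]_(x in `[0%R, +oo[) g x|%R <= C / k.
Proof.
move=> k0 cg h.
have C0 : 0 <= C.
  by have := h 0 (lexx _); rewrite mulr0 oppr0 expR0 mulr1; apply: le_trans.
have eg : edecay g by exists k, C.
have ig := edecay_integrable cg eg.
apply: (le_trans (le_normr_Rintegral _ ig)) => //.
have <- : (\int[mu]_(x in `[0%R, +oo[) (C * expR (- (k * x))) = C / k)%R.
  by rewrite /Rintegral expR_integral.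
apply: le_Rintegral => //.
- apply: edecay_integrable.
    move=> x; apply: (@continuous_comp _ _ _ g Num.norm x); [exact: cg | exact: norm_continuous].
  by exists k, C; split=> // r r0; rewrite normr_id h.
- exact: expR_integrable.
- by move=> x /=; rewrite in_itv/= andbT => /h.
Qed.

End ExponentialDecay.

(** * Decay of the derivatives of the regular solution *)
Section DecayingProfile.
Variable R : realType.
Implicit Types (tau lam x r a b e : R).
Local Notation mu := (@lebesgue_measure R).

Lemma ddphi_cont tau lam : continuous (ddphi tau lam).
Proof.
move=> x; apply: drv_cont; apply: psum_drv.
exact/entire_diffs/entire_diffs/coef_entire.
Qed.

Lemma pot_cont tau lam : continuous (pot tau lam).
Proof.
move=> x; apply: drv_cont (_ : is_derive x 1 _ (2 * (x - tau))).
by eapply drv_eq; [rewrite /pot; drv | rewrite /=; ring].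
Qed.

(** The continuous extension of [phi' / r] to the origin. *)
Definition dphi_over tau lam r := pot tau lam r * phi tau lam r - ddphi tau lam r.

Lemma dphi_overE tau lam r : 0 < r -> dphi_over tau lam r = dphi tau lam r / r.
Proof. by move=> r0; rewrite /dphi_over ddphiE//; ring. Qed.

Lemma dphi_over_cont tau lam : continuous (dphi_over tau lam).
Proof.
move=> x; apply: cvgB; last exact: ddphi_cont.
by apply: cvgM; [exact: pot_cont | exact: phi_cont].
Qed.

Section Decaying.
Variables tau lam : R.
Hypothesis D : decaying tau lam.

Lemma decaying_C : exists C : R, 0 <= C /\ forall r, 0 <= r ->
  `|phi tau lam r| <= C * expR (- r) /\ `|dphi tau lam r| <= C * expR (- r).
Proof.
have [C hC] := D; exists C; split=> //.
by have [h _] := hC 0 (lexx _); move: h; rewrite oppr0 expR0 mulr1; apply: le_trans.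
Qed.

Lemma edecay_phi : edecay (phi tau lam).
Proof.
by have [C [C0 h]] := decaying_C; exists 1, C; split=> // r /h[h1 _]; rewrite mul1r.
Qed.

Lemma edecay_dphi : edecay (dphi tau lam).
Proof.
by have [C [C0 h]] := decaying_C; exists 1, C; split=> // r /h[_ h1]; rewrite mul1r.
Qed.

Lemma edecay_dphi_over : edecay (dphi_over tau lam).
Proof.
have [C [C0 h]] := decaying_C.
have [|C' [C'0 h']] := @bounded_decay _ _ 1 C (@dphi_over_cont tau lam).
  move=> r r1; have r0 : 0 < r by lra.
  have [_ h1] := h r (ltW r0); apply: le_trans h1.
  rewrite dphi_overE// normrM normfV (gtr0_norm r0) ler_pdivrMr//.
  by rewrite ler_peMr.
by exists 1, C'; split=> // r /h'; rewrite mul1r.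
Qed.

Lemma edecay_pot_phi : edecay (fun r => pot tau lam r * phi tau lam r).
Proof.
have e1 := edecay_phi; have e2 := edecayX e1; have e3 := edecayX e2.
apply: edecay_eq (edecayD e3 (edecayD (edecayZ (- (2 * tau)) e2) (edecayZ (tau ^+ 2 - lam) e1))) => r.
by rewrite /pot; ring.
Qed.

Lemma edecay_ddphi : edecay (ddphi tau lam).
Proof.
apply: edecay_eq (edecayD edecay_pot_phi (edecayZ (-1) edecay_dphi_over)) => r.
by rewrite /dphi_over; ring.
Qed.
End Decaying.

End DecayingProfile.

(** * Complex multiples of real functions *)
Section ScaledReal.
Variable R : realType.
Implicit Types (g h : R -> R) (c : R[i]) (u v : R -> R[i]) (x r a b : R).
Local Notation mu := (@lebesgue_measure R).
Local Notation hl := (@halfline R).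
Local Notation normc := (@ComplexField.Normc.normc R).

Definition scaled c g : R -> R[i] := fun r => c * (g r)%:C.

Lemma Re_scaled c g r : complex.Re (scaled c g r) = complex.Re c * g r.
Proof. by rewrite /scaled; case: c => x y /=; rewrite mulr0 subr0. Qed.

Lemma Im_scaled c g r : complex.Im (scaled c g r) = complex.Im c * g r.
Proof. by rewrite /scaled; case: c => x y /=; rewrite mulr0 add0r. Qed.

Lemma normc_real (x : R) : normc x%:C = `|x|.
Proof. by rewrite /normc /= expr0n/= addr0 sqrtr_sqr. Qed.

Lemma normc_scaled c g r : normc (scaled c g r) = normc c * `|g r|.
Proof. by rewrite /scaled ComplexField.Normc.normcM normc_real. Qed.

Lemma measurable_halfline : measurable (@halfline R).
Proof. exact: measurable_itv. Qed.

Lemma halflineP r : hl r <-> 0 < r.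
Proof. by rewrite /halfline /= in_itv/= andbT. Qed.

Lemma halfline_sub : hl `<=` `[0%R, +oo[.
Proof. by move=> x /halflineP x0; rewrite /= in_itv/= andbT ltW. Qed.

Lemma integral_halfline (f : R -> \bar R) : measurable_fun [set: R] f ->
  (\int[mu]_(x in hl) f x = \int[mu]_(x in `[0%R, +oo[) f x)%E.
Proof.
by move=> mf; rewrite /halfline integral_itv_obnd_cbnd//; exact: measurable_funTS.
Qed.

Lemma cmeasurable_scaled c g u : continuous g -> (forall r, 0 < r -> u r = scaled c g r) ->
  cmeasurable u.
Proof.
move=> cg hu; split.
- apply: (@eq_measurable_fun _ _ _ _ _ (fun r => complex.Re c * g r)).
    by move=> r; rewrite inE => /halflineP r0; rewrite hu// Re_scaled.
  by apply: continuous_measurable_on => x; apply: cvgM; [exact: cvg_cst | exact: cg].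
- apply: (@eq_measurable_fun _ _ _ _ _ (fun r => complex.Im c * g r)).
    by move=> r; rewrite inE => /halflineP r0; rewrite hu// Im_scaled.
  by apply: continuous_measurable_on => x; apply: cvgM; [exact: cvg_cst | exact: cg].
Qed.

Lemma integral_edecay_lty g : continuous g -> edecay g -> (forall r, 0 < r -> 0 <= g r) ->
  (\int[mu]_(x in hl) (g x)%:E < +oo)%E.
Proof.
move=> cg eg g0.
have ig : mu.-integrable hl (EFin \o g).
  by apply: integrableS (edecay_integrable cg eg) => //;
    [exact: measurable_halfline | exact: halfline_sub].
have -> : (\int[mu]_(x in hl) (g x)%:E = \int[mu]_(x in hl) `|(EFin \o g) x|)%E.
  apply: eq_integral => x; rewrite inE => /halflineP x0.
  by rewrite /= ger0_norm ?g0.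
by have /integrableP[] := ig.
Qed.

Lemma L2_scaled c g u : continuous g -> edecay g ->
  (forall r, 0 < r -> u r = scaled c g r) -> L2 u.
Proof.
move=> cg eg hu; split; first exact: cmeasurable_scaled hu.
have -> : sqnorm u = (\int[mu]_(x in hl) (normc c ^+ 2 * (g x * g x))%:E)%E.
  apply: eq_integral => x; rewrite inE => /halflineP x0; rewrite hu// normc_scaled exprMn.
  by congr (_ * _)%:E; rewrite -normrX ger0_norm ?sqr_ge0.
apply: integral_edecay_lty.
- by move=> x; apply: cvgM; [exact: cvg_cst | apply: cvgM; exact: cg].
- by apply: edecayZ; exact: edecayM.
- by move=> r _; rewrite mulr_ge0 ?sqr_ge0// -expr2 sqr_ge0.
Qed.

Lemma sqnorm_r_scaled c g u : (forall r, 0 < r -> u r = scaled c g r) ->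
  sqnorm_r u = (\int[mu]_(x in hl) (normc c ^+ 2 * (x * g x * g x))%:E)%E.
Proof.
move=> hu; apply: eq_integral => x; rewrite inE => /halflineP x0.
rewrite hu// normc_scaled exprMn; congr (_%:E).
by rewrite -normrX ger0_norm ?sqr_ge0//; ring.
Qed.

Lemma L2r_scaled c g u : continuous g -> edecay g ->
  (forall r, 0 < r -> u r = scaled c g r) -> L2r u.
Proof.
move=> cg eg hu; split; first exact: cmeasurable_scaled hu.
rewrite (sqnorm_r_scaled hu); apply: integral_edecay_lty.
- move=> x; apply: cvgM; [exact: cvg_cst | apply: cvgM; last exact: cg].
  by apply: cvgM; [exact: cvg_id | exact: cg].
- by apply: edecayZ; apply: edecayM => //; exact: edecayX.
- by move=> r r0; rewrite mulr_ge0 ?sqr_ge0// -mulrA mulr_ge0 ?(ltW r0)// -expr2 sqr_ge0.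
Qed.

Lemma continuous_integrable_segment g a b : continuous g ->
  mu.-integrable `[a, b] (EFin \o g).
Proof.
move=> cg; apply: continuous_compact_integrable; first exact: segment_compact.
exact: continuous_subspaceT.
Qed.

Lemma FTC2_segment g g' a b : (forall x, is_derive x 1 g (g' x)) ->
  continuous g' -> a <= b -> (\int[mu]_(x in `[a, b]) g' x = g b - g a)%R.
Proof.
move=> dg cg'; rewrite le_eqVlt => /predU1P[->|ab].
  by rewrite set_itv1 Rintegral_set1 subrr.
have cg : continuous g by move=> x; exact: drv_cont (dg x).
rewrite /Rintegral (@continuous_FTC2 _ g' g)//.
- exact: continuous_subspaceT.
- split; first by move=> x _; case: (dg x).
    by apply: cvg_at_right_filter; exact: cg.
  by apply: cvg_at_left_filter; exact: cg.
- by move=> x _; rewrite derive1E; case: (dg x).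
Qed.

(** Real and imaginary parts are treated at once by letting [p] range over the
    two projections. *)
Lemma ac_deriv_scaled c g g' u : (forall x, is_derive x 1 g (g' x)) ->
  continuous g' -> (forall r, 0 < r -> u r = scaled c g' r) -> ac_deriv (scaled c g) u.
Proof.
move=> dg cg' hu a b a0 ab.
have hR (p : R[i] -> R) (d : R) : (forall h r, p (scaled c h r) = d * h r) ->
    mu.-integrable `[a, b] (fun r => (p (u r))%:E) /\
    (\int[mu]_(r in `[a, b]) p (u r))%R = d * (g b - g a).
  move=> hp; have cdg : continuous (fun x => d * g' x).
    by move=> x; apply: cvgM; [exact: cvg_cst | exact: cg'].
  have E : {in `[a, b]%classic, (fun r => p (u r)) =1 (fun x => d * g' x)}.
    move=> r; rewrite inE /= ?in_itv /= => /andP[ar _].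
    by rewrite hu ?hp//; exact: lt_le_trans a0 ar.
  split.
    apply: eq_integrable (continuous_integrable_segment a b cdg) => //.
    by move=> r rab; rewrite /= (E r rab).
  have -> : (\int[mu]_(r in `[a, b]) p (u r) = \int[mu]_(r in `[a, b]) (d * g' r))%R by exact: eq_Rintegral.
  rewrite RintegralZl//; last exact: continuous_integrable_segment.
  by rewrite (FTC2_segment dg).
have [i1 e1] := hR (@complex.Re R) (complex.Re c) (Re_scaled c).
have [i2 e2] := hR (@complex.Im R) (complex.Im c) (Im_scaled c).
split; first by split.
rewrite /cintegral e1 e2; rewrite /scaled; case: c {hR hu i1 i2 e1 e2} => x y.
by simpc; congr (_ +i* _); rewrite mulrBr.
Qed.

End ScaledReal.

(** * Weak solutions *)
Section AbsolutelyContinuous.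
Variable R : realType.
Implicit Types (u v g : R -> R) (x r a b : R).
Local Notation mu := (@lebesgue_measure R).
Local Notation hl := (@halfline R).

Definition ac_real u v := forall a b : R, 0 < a -> a <= b ->
  mu.-integrable `[a, b] (EFin \o v) /\ u b - u a = (\int[mu]_(x in `[a, b]) v x)%R.

(** A primitive of an integrable function is continuous. *)
Lemma ac_real_cont u v : ac_real u v -> forall r, 0 < r -> {for r, continuous u}.
Proof.
move=> h r r0; have r20 : 0 < r / 2 by rewrite divr_gt0.
have r2r : r / 2 < r by lra.
have ab : r / 2 < r + 1 by lra.
have [iv _] := h _ _ r20 (ltW ab).
have cF := parameterized_integral_continuous (ltW ab) iv.
have cu : {within `[r / 2, r + 1], continuous u}.
  have cF' : {within `[r / 2, r + 1], continuous
      (fun x => u (r / 2) + (\int[mu]_(t in `[r / 2, x]) v t)%R)}.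
    by move=> x; apply: cvgD; [exact: cvg_cst | exact: cF].
  apply: subspace_eq_continuous cF' => x; rewrite inE /= in_itv /= => /andP[h1 h2].
  have [_ E] := h _ _ r20 h1.
  by rewrite /from_subspace /= -E addrC subrK.
have [cuo _ _] := (continuous_within_itvP _ ab).1 cu.
by apply: cuo; rewrite in_itv/= r2r /=; lra.
Qed.

(** Replacing [v] by [g] under the integral sign makes the first fundamental
    theorem apply at every point. *)
Lemma ac_real_drv u v g : ac_real u v -> v = g %[ae mu in hl] ->
  (forall r, 0 < r -> {for r, continuous g}) ->
  forall r, 0 < r -> is_derive r 1 u (g r).
Proof.
move=> h vg cg r r0; have r20 : 0 < r / 2 by rewrite divr_gt0.
have r2r : r / 2 < r by lra.
have rr1 : r < r + 1 by lra.
have ig b : mu.-integrable `[r / 2, b] (EFin \o g).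
  apply: continuous_compact_integrable; first exact: segment_compact.
  apply: continuous_in_subspaceT => x; rewrite inE/= in_itv/= => /andP[h1 _].
  by apply: cg; exact: lt_le_trans h1.
have [dF F'] := continuous_FTC1_closed rr1 (ig (r + 1)) r2r (cg r r0).
set F := (fun x => (\int[mu]_(t in `[r / 2, x]) g t)%R) in dF F'.
have dF1 : is_derive r 1 F (g r) by rewrite -F' derive1E; exact: derivableP.
apply: (@near_eq_is_derive _ _ _ (fun x => u (r / 2) + F x)); last first.
  by eapply drv_eq; [drv | rewrite add0r].
have : \forall x \near r, r / 2 < x by apply: lt_nbhsr.
apply: filterS => x hx.
have [iv E] := h _ _ r20 (ltW hx).
have mab : measurable (`[r / 2, x] : set R) by exact: measurable_itv.
have -> : F x = (\int[mu]_(t in `[r / 2, x]) v t)%R; last by rewrite -E addrC subrK.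
congr fine; apply: ae_eq_integral => //.
- by have /integrableP[] := ig x.
- by have /integrableP[] := iv.
- move: vg; apply: (@filterS _ _ (ae_filter_ringOfSetsType mu)) => t ht; rewrite /= in_itv/= => /andP[h1 _].
  by rewrite /= ht//; apply/halflineP; exact: lt_le_trans h1.
Qed.

(** Regularity by bootstrapping: [y] and [y1] are continuous as primitives, so
    [y2] is almost everywhere equal to a continuous function. *)
Lemma ac_real_ode tau lam (y y1 y2 : R -> R) : ac_real y y1 -> ac_real y1 y2 ->
  y2 = (fun r => pot tau lam r * y r - y1 r / r) %[ae mu in hl] ->
  (forall r, 0 < r -> is_derive r 1 y (y1 r)) /\
  (forall r, 0 < r -> is_derive r 1 y1 (pot tau lam r * y r - y1 r / r)).
Proof.
move=> h0 h1 h2; have c0 := ac_real_cont h0; have c1 := ac_real_cont h1.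
split.
  by apply: (ac_real_drv h0) c1; apply: aeW.
apply: (ac_real_drv h1 h2) => r r0; apply: cvgB.
  by apply: cvgM; [exact: pot_cont | exact: c0].
apply: cvgM; first exact: c1.
by apply: cvgV; [rewrite gt_eqF | exact: cvg_id].
Qed.

(** Among the classical solutions on the open half-line, the condition
    [r y' -> 0] at the origin singles out the multiples of the regular one:
    it makes the Wronskian with that solution vanish. *)
Lemma regular_at0 tau lam (y y1 : R -> R) :
  (forall r, 0 < r -> is_derive r 1 y (y1 r)) ->
  (forall r, 0 < r -> is_derive r 1 y1 (pot tau lam r * y r - y1 r / r)) ->
  (forall e, 0 < e -> exists2 d : R, 0 < d & forall r, 0 < r -> r < d -> `|r * y1 r| < e) ->
  exists c : R, forall r, 0 < r -> y r = c * phi tau lam r /\ y1 r = c * dphi tau lam r.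
Proof.
move=> dy dy1 lim0.
pose W r := r * y1 r * phi tau lam r - y r * (r * dphi tau lam r).
have dW r : 0 < r -> is_derive r 1 W 0.
  move=> r0; have h1 := dy r r0; have h2 := dy1 r r0.
  have h3 := phi_drv tau lam r; have h4 := rdphi_drv tau lam r.
  by eapply drv_eq; [rewrite /W; drv | rewrite /=; field; rewrite gt_eqF].
have Wc a b : 0 < a -> a <= b -> W a = W b.
  move=> a0 ab; have [|c [_ E]] := @drv_mvt _ W (fun=> 0) a b ab.
    by move=> x /andP[ax _]; apply: dW; exact: lt_le_trans ax.
  by move: E; rewrite mul0r => /eqP; rewrite subr_eq0 eq_sym => /eqP.
have [M M0 hM] := segment_bounded 1 (@phi_cont _ tau lam).
have [M' M'0 hM'] := segment_bounded 1 (@ddphi_cont _ tau lam).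
have dphi_le r : 0 <= r <= 1 -> `|dphi tau lam r| <= M' * r.
  move=> /andP[r0 r1].
  have [c [/andP[c0 cr] E]] := drv_mvt r0 (fun x _ => dphi_drv tau lam x).
  move: E; rewrite dphi0 !subr0 => ->; rewrite normrM (ger0_norm r0) ler_wpM2r//.
  by apply: hM'; rewrite c0 (le_trans cr).
suff H e : 0 < e -> exists2 d : R, 0 < d & `|W d| <= e.
  have W0 r : 0 < r -> W r = 0.
    move=> r0; apply/eqP; rewrite -normr_le0; apply/ler_addgt0Pr => e e0; rewrite add0r.
    have [d d0 h] := H e e0; have [rd|/ltW dr] := leP r d.
      by rewrite (Wc r d).
    by rewrite -(Wc d r).
  have [rho rho0 hrho] := phi_near0 tau lam.
  have pr : 1 / 2 <= phi tau lam rho by apply: hrho; rewrite lexx ltW.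
  have pn : phi tau lam rho != 0 by rewrite gt_eqF//; lra.
  pose c := y rho / phi tau lam rho.
  pose Y r := y r - c * phi tau lam r.
  pose Y1 r := y1 r - c * dphi tau lam r.
  have dY r : 0 < r -> is_derive r 1 Y (Y1 r).
    move=> r0; have h1 := dy r r0; have h3 := phi_drv tau lam r.
    by eapply drv_eq; [rewrite /Y; drv | rewrite /Y1 /=; ring].
  have dY1 r : 0 < r -> is_derive r 1 Y1 (pot tau lam r * Y r - Y1 r / r).
    move=> r0; have h1 := dy1 r r0; have h3 := dphi_drv tau lam r.
    by eapply drv_eq; [rewrite /Y1; drv | rewrite /Y1 /Y /= ddphiE//; field; rewrite gt_eqF].
  have Yr : Y rho = 0 by rewrite /Y /c divfK// subrr.
  have Y1r : Y1 rho = 0.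
    have := W0 rho rho0; rewrite /W => /eqP; rewrite subr_eq0 => /eqP E.
    apply: (mulfI (lt0r_neq0 rho0)); apply: (mulIf pn).
    rewrite mulr0 mul0r /Y1 mulrBr mulrBl E /c.
    by field.
  have YE := ode_unique dY dY1 rho0 Yr Y1r.
  have W0Y r : 0 < r -> y r = c * phi tau lam r.
    by move=> r0; have := YE r r0; rewrite /Y => /eqP; rewrite subr_eq0 => /eqP.
  exists c => r r0; split; first exact: W0Y.
  have h : is_derive r 1 y (c * dphi tau lam r).
    apply: (@near_eq_is_derive _ _ _ (fun x => c * phi tau lam x)).
      have : \forall x \near r, 0 < x by apply: lt_nbhsr.
      by apply: filterS => x x0; rewrite W0Y.
    have h3 := phi_drv tau lam r.
    by eapply drv_eq; [drv | rewrite /=; ring].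
  by case: h => _ <-; case: (dy r r0).
move=> e0.
pose e1 : R := e / (M + 2 * M').
have MM : 0 < M + 2 * M' by rewrite addr_gt0// mulr_gt0.
have e10 : 0 < e1 by rewrite divr_gt0.
have [d1 d10 h1] := lim0 e1 e10.
have [d2 d20 h2] := lim0 1 ltr01.
pose p : R := Num.min (Num.min 1 (d2 / 2)) e1.
have p0 : 0 < p by rewrite !lt_min e10 ltr01 divr_gt0.
have p1 : p <= 1 by rewrite !ge_min lexx.
have pd2 : p <= d2 / 2 by rewrite !ge_min lexx orbT.
have pe1 : p <= e1 by rewrite ge_min lexx orbT.
pose q : R := e1 / (`|y p| + 1).
have yp : 0 < `|y p| + 1 by rewrite ltr_wpDl.
have q0 : 0 < q by rewrite divr_gt0.
pose r : R := Num.min (Num.min p (d1 / 2)) q.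
have r0 : 0 < r by rewrite lt_min q0 lt_min p0 divr_gt0.
have rp : r <= p by rewrite ge_min ge_min lexx.
have rd1 : r <= d1 / 2 by rewrite ge_min ge_min lexx orbT.
have rq : r <= q by rewrite ge_min lexx orbT.
have r01 : 0 <= r <= 1 by rewrite ltW//= (le_trans rp).
exists r => //.
have b1 : `|r * y1 r| <= e1 by apply: ltW; apply: h1 => //; clear - rd1 d10; lra.
(* Between r and p the derivative y1 is at most 1 / r in absolute value, so
   that |r y| is at most r |y p| + p. *)
have b2 : `|r * y r| <= 2 * e1.
  have [|c [/andP[rc cp] E]] := @drv_mvt _ y y1 r p rp.
    by move=> x /andP[rx _]; apply: dy; exact: lt_le_trans rx.
  have c0 : 0 < c := lt_le_trans r0 rc.
  have hc : `|c * y1 c| <= 1 by apply: ltW; apply: h2 => //; clear - cp pd2 d20; lra.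
  have -> : r * y r = r * y p - r * y1 c * (p - r).
    by rewrite -[r * y1 c * _]mulrA -E; ring.
  rewrite (le_trans (ler_normB _ _))// (_ : 2 * e1 = e1 + e1); last by ring.
  apply: lerD.
    rewrite normrM (gtr0_norm r0).
    apply: (@le_trans _ _ (q * (`|y p| + 1))); last by rewrite divfK ?gt_eqF.
    by rewrite ler_pM// ?(ltW r0)// lerDl.
  rewrite normrM; apply: (@le_trans _ _ (1 * p)); last by rewrite mul1r.
  apply: ler_pM => //.
    apply: le_trans hc; rewrite !normrM (gtr0_norm r0) (gtr0_norm c0).
    by rewrite ler_wpM2r.
  by rewrite ger0_norm ?subr_ge0//; clear - r0; lra.
have -> : W r = r * y1 r * phi tau lam r - r * y r * dphi tau lam r by rewrite /W; ring.
rewrite (le_trans (ler_normB _ _))// !normrM -!normrM.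
apply: (@le_trans _ _ (e1 * M + 2 * e1 * M')).
  apply: lerD; rewrite normrM ler_pM// ?hM//.
  by rewrite (le_trans (dphi_le r r01))// ler_piMr ?(ltW M'0)//; case/andP: r01.
rewrite (_ : _ + _ = e1 * (M + 2 * M')); last by ring.
by rewrite /e1 divfK ?gt_eqF.
Qed.

End AbsolutelyContinuous.

(** * Eigenfunctions and decaying solutions *)
Section Spectrum.
Variable R : realType.
Implicit Types (c : R[i]) (u v z w : R -> R[i]) (tau lam x r a b : R).
Local Notation mu := (@lebesgue_measure R).
Local Notation hl := (@halfline R).
Local Notation normc := (@ComplexField.Normc.normc R).

Lemma aeW_halfline u v : (forall r, 0 < r -> u r = v r) -> aeeq u v.
Proof. by move=> h; apply: aeW => x /halflineP/h. Qed.

Lemma real_mul_scaled (x : R) c g r : x%:C * scaled c g r = scaled c (fun y => x * g y) r.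
Proof. by rewrite /scaled mulrCA -rmorphM. Qed.

Section Decaying.
Variables (tau lam : R).
Hypothesis D : decaying tau lam.
Variable c : R[i].
Let w := scaled c (phi tau lam).
Let w1 := scaled c (dphi tau lam).
Let w2 := scaled c (ddphi tau lam).

Let mulpowE k r : mulpow k w r = scaled c (fun x => x ^+ k * phi tau lam x) r.
Proof. by rewrite /mulpow real_mul_scaled. Qed.

Let cX k : continuous (fun x : R => x ^+ k * phi tau lam x).
Proof. by move=> x; apply: cvgM; [exact: exprn_continuous | exact: phi_cont]. Qed.

Let eX k : edecay (fun x : R => x ^+ k * phi tau lam x).
Proof.
elim: k => [|k IH]; first by apply: edecay_eq (edecay_phi D) => x; rewrite expr0 mul1r.
by apply: edecay_eq (edecayX IH) => x; rewrite exprS mulrA.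
Qed.

Lemma dom_g_phi : dom_g w w1 w2.
Proof.
have cphi := @phi_cont _ tau lam; have cd := @dphi_cont _ tau lam.
have cdd := @ddphi_cont _ tau lam.
split.
- split.
  + by apply: ac_deriv_scaled cd _ => // r; exact: phi_drv.
  + by apply: (@L2r_scaled _ c _ _ cphi (edecay_phi D)).
  + by apply: (@L2r_scaled _ c _ _ cd (edecay_dphi D)).
  + by apply: (@L2r_scaled _ c _ _ (@cX 1) (@eX 1)) => r _; rewrite mulpowE.
- split; first by apply: ac_deriv_scaled cdd _ => // r; exact: dphi_drv.
  by apply: (@L2r_scaled _ c _ _ cdd (edecay_ddphi D)).
- apply: (@L2r_scaled _ c _ _ (@dphi_over_cont _ tau lam) (edecay_dphi_over D)) => r r0.
  by rewrite /divr /w1 real_mul_scaled /scaled dphi_overE//; congr (_ * _%:C); rewrite mulrC.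
- by apply: (@L2r_scaled _ c _ _ (@cX 2) (@eX 2)) => r _; rewrite mulpowE.
- have -> : (fun r => r * normc (w1 r)) = (fun r => r * (normc c * `|dphi tau lam r|)).
    by apply/funext => r; rewrite normc_scaled.
  rewrite -[X in _ --> X](mul0r (normc c * `|dphi tau lam 0|)).
  apply: cvg_at_right_filter; apply: cvgM; first exact: cvg_id.
  by apply: cvgM; [exact: cvg_cst | apply: cvg_norm; exact: cd].
Qed.

Lemma dom_h_phi : dom_h w w1 w2.
Proof.
have cphi := @phi_cont _ tau lam; have cd := @dphi_cont _ tau lam.
have cdd := @ddphi_cont _ tau lam.
split.
- split.
  + by apply: ac_deriv_scaled cd _ => // r; exact: phi_drv.
  + by apply: (@L2_scaled _ c _ _ cphi (edecay_phi D)).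
  + by apply: (@L2_scaled _ c _ _ cd (edecay_dphi D)).
  + by apply: (@L2_scaled _ c _ _ (@cX 1) (@eX 1)) => r _; rewrite mulpowE.
- split; first by apply: ac_deriv_scaled cdd _ => // r; exact: dphi_drv.
  by apply: (@L2_scaled _ c _ _ cdd (edecay_ddphi D)).
- by apply: (@L2_scaled _ c _ _ (@cX 2) (@eX 2)) => r _; rewrite mulpowE.
- have -> : (fun r => normc (w1 r)) = (fun r => (normc c * `|dphi tau lam r|)).
    by apply/funext => r; rewrite normc_scaled.
  have z0 : normc c * `|dphi tau lam 0| = 0 by rewrite dphi0 normr0 mulr0.
  rewrite -[X in _ --> X]z0.
  apply: cvg_at_right_filter.
  by apply: cvgM; [exact: cvg_cst | apply: cvg_norm; exact: cd].
Qed.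

Lemma op_g_phi : op_g tau w (fun r => lam%:C * w r).
Proof.
have cphi := @phi_cont _ tau lam.
split.
- by apply: (@L2r_scaled _ c _ _ cphi (edecay_phi D)).
- apply: (@L2r_scaled _ c (fun x => lam * phi tau lam x)).
  + by move=> x; apply: cvgM; [exact: cvg_cst | exact: cphi].
  + by apply: edecayZ; exact: edecay_phi.
  + by move=> r _; rewrite real_mul_scaled.
- exists w, w1, w2; split; [exact: aeW_halfline | exact: dom_g_phi |].
  apply: aeW_halfline => r r0.
  rewrite /w /w1 /w2 /divr !real_mul_scaled /scaled -mulrN -mulrBr -mulrDr.
  rewrite -rmorphN -rmorphB -rmorphD ddphiE//; congr (_ * _%:C).
  by rewrite /pot; field; rewrite gt_eqF.
Qed.

End Decaying.

(** An interval of positive length is not negligible. *)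
Lemma ae_witness (P : R -> Prop) a b : 0 <= a -> a < b ->
  (\forall x \ae mu, hl x -> P x) -> exists x, [/\ a < x, x < b & P x].
Proof.
move=> a0 ab [N [mN N0 H]]; apply: contrapT => nex.
have sub : (`]a, b[ : set R) `<=` N.
  move=> x; rewrite /= in_itv/= => /andP[ax xb]; apply: H => /= hx.
  apply: nex; exists x; split=> //; apply: hx; apply/halflineP; exact: le_lt_trans ax.
have : (mu (`]a, b[ : set R) <= mu N)%E.
  by apply: le_measure => //; rewrite inE//; exact: measurable_itv.
rewrite N0 lebesgue_measure_itv /= lte_fin ab.
by rewrite -EFinB lee_fin subr_le0 leNgt ab.
Qed.

Lemma scaled_phi_neq0 tau lam c : c != 0 -> ~ aeeq (scaled c (phi tau lam)) (fun=> 0).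
Proof.
move=> c0 /ae_witness H; have [rho rho0 hr] := phi_near0 tau lam.
have [x [x0 xr]] := H 0 rho (lexx _) rho0.
move=> /eqP; rewrite /scaled mulf_eq0 (negPf c0) /= => /eqP [] h.
have xr2 : 0 <= x <= rho by rewrite (ltW x0) (ltW xr).
by have := hr x xr2; rewrite h; lra.
Qed.

Lemma decaying_eigenvalue tau lam : decaying tau lam -> Defs.eigenvalue tau lam.
Proof.
move=> D; exists (scaled 1 (phi tau lam)); split; first exact: op_g_phi.
by apply: scaled_phi_neq0; exact: oner_neq0.
Qed.

Lemma ac_deriv_real u v : ac_deriv u v ->
  ac_real (fun r => complex.Re (u r)) (fun r => complex.Re (v r)) /\
  ac_real (fun r => complex.Im (u r)) (fun r => complex.Im (v r)).
Proof.
move=> h; split=> a b a0 ab; have [[i1 i2] E] := h a b a0 ab; split=> //.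
  have := congr1 (@complex.Re R) E.
  by case: (u a) (u b) => [x1 y1] [x2 y2] /=.
have := congr1 (@complex.Im R) E.
by case: (u a) (u b) => [x1 y1] [x2 y2] /=.
Qed.

Lemma normc_ge_ReIm (z : R[i]) : `|complex.Re z| <= normc z /\ `|complex.Im z| <= normc z.
Proof.
case: z => x y /=; rewrite -!sqrtr_sqr.
by split; apply: ler_wsqrtr; rewrite ?lerDl ?lerDr sqr_ge0.
Qed.

(** The real and imaginary parts of an eigenfunction solve the same real
    equation, so [regular_at0] applies to each. *)
Lemma op_g_regular tau lam z : op_g tau z (fun r => lam%:C * z r) ->
  exists c, aeeq z (scaled c (phi tau lam)).
Proof.
case=> _ _ [w [w1 [w2 [zw dom fw]]]].
case: dom => [[ac0 _ _ _] [ac1 _] _ _ lim0].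
have [r0 i0] := ac_deriv_real ac0; have [r1 i1] := ac_deriv_real ac1.
have E : aeeq w2 (fun r => (pot tau lam r)%:C * w r - (r^-1)%:C * w1 r).
  move: zw fw; apply: (@filterS2 _ _ (ae_filter_ringOfSetsType mu)) => r h1 h2 hr.
  have {}h1 := h1 hr; have {}h2 := h2 hr; rewrite h1 /divr in h2.
  rewrite /pot rmorphB /= mulrBl h2; ring.
have ER : (fun r => complex.Re (w2 r)) =
    (fun r => pot tau lam r * complex.Re (w r) - complex.Re (w1 r) / r) %[ae mu in hl].
  move: E; apply: (@filterS _ _ (ae_filter_ringOfSetsType mu)) => r h hr.
  rewrite h//; case: (w r) (w1 r) => [a b] [a' b'] /=; ring.
have EI : (fun r => complex.Im (w2 r)) =
    (fun r => pot tau lam r * complex.Im (w r) - complex.Im (w1 r) / r) %[ae mu in hl].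
  move: E; apply: (@filterS _ _ (ae_filter_ringOfSetsType mu)) => r h hr.
  rewrite h//; case: (w r) (w1 r) => [a b] [a' b'] /=; ring.
have lim e : 0 < e -> exists2 d : R, 0 < d & forall r, 0 < r -> r < d -> r * normc (w1 r) < e.
  move=> e0; move/cvgrPdist_lt : lim0 => /(_ e e0).
  rewrite /at_right /within /= => /nbhs_ballP[d /= d0 H]; exists d => // r rp rd.
  have := H r; rewrite /ball /= sub0r normrN gtr0_norm// => /(_ rd rp).
  by rewrite sub0r normrN; apply: le_lt_trans; exact: ler_norm.
have [dR dR1] := ac_real_ode r0 r1 ER.
have [dI dI1] := ac_real_ode i0 i1 EI.
have [|cR hR] := regular_at0 dR dR1.
  move=> e e0; have [d d0 H] := lim e e0; exists d => // r rp rd.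
  apply: le_lt_trans (H r rp rd); rewrite normrM (gtr0_norm rp) ler_pM2l//.
  by have [] := normc_ge_ReIm (w1 r).
have [|cI hI] := regular_at0 dI dI1.
  move=> e e0; have [d d0 H] := lim e e0; exists d => // r rp rd.
  apply: le_lt_trans (H r rp rd); rewrite normrM (gtr0_norm rp) ler_pM2l//.
  by have [] := normc_ge_ReIm (w1 r).
exists (cR +i* cI); move: zw; apply: (@filterS _ _ (ae_filter_ringOfSetsType mu)) => r h hr.
rewrite h//; have rp : 0 < r by exact/halflineP.
have := hR r rp; have := hI r rp; rewrite /scaled.
by case: (w r) => a b /= [-> _] [-> _]; simpc.
Qed.

End Spectrum.

(** * Norms and the virial identity *)
Section SquareNorms.
Variable R : realType.
Implicit Types (c : R[i]) (u v z w : R -> R[i]) (tau lam x r a b : R).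
Local Notation mu := (@lebesgue_measure R).
Local Notation hl := (@halfline R).
Local Notation normc := (@ComplexField.Normc.normc R).

Lemma normc_sqr (z : R[i]) : normc z ^+ 2 = complex.Re z ^+ 2 + complex.Im z ^+ 2.
Proof. by case: z => x y /=; rewrite sqr_sqrtr// addr_ge0 ?sqr_ge0. Qed.

Lemma measurable_normc2 u : cmeasurable u -> measurable_fun hl (fun r => normc (u r) ^+ 2).
Proof.
case=> mR mI.
apply: (@eq_measurable_fun _ _ _ _ _ (fun r => complex.Re (u r) ^+ 2 + complex.Im (u r) ^+ 2)).
  by move=> r _; rewrite normc_sqr.
by apply: measurable_funD; exact: measurable_funX.
Qed.

Lemma sqnorm_ae u v : cmeasurable u -> cmeasurable v -> aeeq u v -> sqnorm u = sqnorm v.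
Proof.
move=> mu_ mv uv; apply: ge0_ae_eq_integral.
- exact: measurable_halfline.
- by apply/measurable_EFinP; exact: measurable_normc2.
- by apply/measurable_EFinP; exact: measurable_normc2.
- by move=> x _; rewrite lee_fin sqr_ge0.
- by move=> x _; rewrite lee_fin sqr_ge0.
- by move: uv; apply: (@filterS _ _ (ae_filter_ringOfSetsType mu)) => r h hr; rewrite h.
Qed.

Lemma sqnorm_r_ae u v : cmeasurable u -> cmeasurable v -> aeeq u v -> sqnorm_r u = sqnorm_r v.
Proof.
move=> mu_ mv uv; apply: ge0_ae_eq_integral.
- exact: measurable_halfline.
- apply/measurable_EFinP; apply: measurable_funM; first exact: measurable_normc2.
  exact: measurable_id.
- apply/measurable_EFinP; apply: measurable_funM; first exact: measurable_normc2.
  exact: measurable_id.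
- by move=> x /halflineP x0; rewrite lee_fin mulr_ge0 ?sqr_ge0// ltW.
- by move=> x /halflineP x0; rewrite lee_fin mulr_ge0 ?sqr_ge0// ltW.
- by move: uv; apply: (@filterS _ _ (ae_filter_ringOfSetsType mu)) => r h hr; rewrite h.
Qed.

Lemma cmeasurable_phi tau lam c : cmeasurable (scaled c (phi tau lam)).
Proof. by apply: cmeasurable_scaled (@phi_cont _ tau lam) _. Qed.

Lemma scaled0 (g : R -> R) : scaled 0 g = fun=> 0.
Proof. by apply/funext => r; rewrite /scaled mul0r. Qed.

(** Without decay the solution would grow, and [|u| ^ 2 r] would be bounded
    below by a positive constant near infinity, hence not integrable. *)
Lemma eigenfunction_phi tau lam z : eigenfunction tau lam z ->
  exists c, [/\ c != 0, aeeq z (scaled c (phi tau lam)) & decaying tau lam].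
Proof.
move=> [Oz nz]; have [c zc] := op_g_regular Oz.
have c0 : c != 0 by apply/eqP => c0; apply: nz; rewrite c0 scaled0 in zc.
exists c; split=> //; apply: contrapT => nd.
have [mz zfin] : L2r z by case: Oz.
rewrite (sqnorm_r_ae mz (cmeasurable_phi tau lam c) zc) in zfin.
have [r0 F] := far_near tau lam.
have F0 : far tau lam r0 by apply: F; rewrite subrr normr0.
have [s [r [ss rr G]]] := not_decaying_growing F0 nd.
have [k k0 H] := growing_persists F0 rr G.
have r1 : 1 <= r by case: F0 => h _; exact: le_trans rr.
have nc0 : 0 < normc c.
  rewrite lt_neqAle; apply/andP; split; last by case: (c) => x y; rewrite /= sqrtr_ge0.
  by rewrite eq_sym; apply/eqP => /ComplexField.Normc.eq0_normc E; rewrite E eqxx in c0.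
pose K : R := normc c ^+ 2 * k ^+ 2.
have K0 : 0 < K by rewrite mulr_gt0// exprn_gt0.
suff : (+oo <= sqnorm_r (scaled c (phi tau lam)))%E.
  by move=> /(lt_le_trans zfin); rewrite ltxx.
rewrite (@sqnorm_r_scaled _ c (phi tau lam))//.
have sub : (`]r, +oo[ : set R) `<=` hl.
  by move=> x; rewrite /= in_itv/= andbT => rx; apply/halflineP; apply: lt_trans rx; lra.
have mr : measurable (`]r, +oo[ : set R) by exact: measurable_itv.
have mf D : measurable_fun D (fun x => (normc c ^+ 2 * (x * phi tau lam x * phi tau lam x))%:E).
  apply/measurable_EFinP; apply: continuous_measurable_on => x.
  apply: cvgM; first exact: cvg_cst.
  by apply: cvgM; [apply: cvgM; [exact: cvg_id|exact: phi_cont] | exact: phi_cont].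
apply: (@le_trans _ _ (\int[mu]_(x in `]r, +oo[) (normc c ^+ 2 * (x * phi tau lam x * phi tau lam x))%:E)%E); last first.
  apply: ge0_subset_integral; [exact: mr | exact: measurable_halfline | exact: mf | | exact: sub].
  move=> x hx; have x0 : 0 < x by exact/halflineP.
  rewrite lee_fin mulr_ge0 ?sqr_ge0//.
  by rewrite -mulrA mulr_ge0 ?(ltW x0)// -expr2 sqr_ge0.
apply: (@le_trans _ _ (\int[mu]_(x in `]r, +oo[) cst K%:E x)%E).
  have mE : mu (`]r, +oo[ : set R) = +oo%E by rewrite lebesgue_measure_itv /= ltry.
  rewrite leye_eq; apply/eqP; transitivity (K%:E * mu (`]r, +oo[ : set R))%E; last by rewrite mE gt0_muley// lte_fin.
  by have := @integral_cst _ _ _ mu (`]r, +oo[ : set R) mr K%:E.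
apply: ge0_le_integral => //.
- by move=> x _; rewrite lee_fin ltW.
- exact: mf.
- move=> x; rewrite /= in_itv/= andbT => rx; rewrite lee_fin /K ler_wpM2l ?sqr_ge0//.
  have [_ h1] := H x (ltW rx).
  have h2 : k <= `|phi tau lam x|.
    apply: (le_trans h1); apply: (le_trans (ler_norm _)).
    by rewrite normrM (sign_norm ss) mul1r.
  have x1 : 1 <= x by lra.
  rewrite -mulrA -expr2; apply: (@le_trans _ _ (phi tau lam x ^+ 2)).
    rewrite -[leRHS]ger0_norm ?sqr_ge0// normrX.
    by apply: lerXn2r; rewrite ?nnegrE// ltW.
  by rewrite ler_peMl ?sqr_ge0.
Qed.

Lemma eigenvalueP tau lam : Defs.eigenvalue tau lam <-> decaying tau lam.
Proof.
split; last exact: decaying_eigenvalue.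
by move=> [z /eigenfunction_phi[c []]].
Qed.

Definition mass tau lam : R :=
  (\int[mu]_(x in `[0%R, +oo[) (x * phi tau lam x * phi tau lam x))%R.

Lemma edecay_mass tau lam : decaying tau lam ->
  edecay (fun x => x * phi tau lam x * phi tau lam x).
Proof. by move=> D; apply: edecayM (edecayX (edecay_phi D)) (edecay_phi D). Qed.

Lemma cont_mass tau lam : continuous (fun x => x * phi tau lam x * phi tau lam x).
Proof.
by move=> x; apply: cvgM; [apply: cvgM; [exact: cvg_id|exact: phi_cont] | exact: phi_cont].
Qed.

Lemma sqnorm_r_mass tau lam c : decaying tau lam ->
  sqnorm_r (scaled c (phi tau lam)) = (normc c ^+ 2 * mass tau lam)%:E.
Proof.
move=> D; rewrite (@sqnorm_r_scaled _ c (phi tau lam))// integral_halfline; last first.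
  apply/measurable_EFinP; apply: continuous_measurable_on => x.
  by apply: cvgM; [exact: cvg_cst | exact: cont_mass].
have im := edecay_integrable (@cont_mass tau lam) (edecay_mass D).
under eq_integral do rewrite EFinM.
rewrite integralZl// [RHS]EFinM; congr (_ * _)%E; rewrite /mass /Rintegral fineK//.
by apply: integrable_fin_num.
Qed.

(** Minus the derivative in [tau] of the quadratic form, at the regular
    solution. *)
Definition moment tau lam : R :=
  (\int[mu]_(x in `[0%R, +oo[) (2 * (x - tau) * (x * phi tau lam x * phi tau lam x)))%R.

(** The function [r V u ^ 2 - r u' ^ 2 - u u'] vanishes at both ends, and the
    sum of the two integrands is its derivative. *)
Lemma virial tau lam : decaying tau lam ->
  (\int[mu]_(x in `[0%R, +oo[) (phi tau lam x * dphi_over tau lam x))%R = - moment tau lam.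
Proof.
move=> D.
set p := phi tau lam; set q := dphi tau lam; set V := pot tau lam.
pose G r := r * (V r * p r) * p r - r * q r * q r - p r * q r.
pose f r := p r * dphi_over tau lam r + 2 * (r - tau) * (r * p r * p r).
have dG r : is_derive r 1 G (f r).
  have h1 := phi_drv tau lam r; have h2 := dphi_drv tau lam r.
  have h3 : is_derive r 1 (pot tau lam) (2 * (r - tau)).
    by eapply drv_eq; [rewrite /pot; drv | rewrite /=; ring].
  eapply drv_eq; first by rewrite /G /p /q /V; drv.
  have ode := phi_ode tau lam r.
  have e1 : dphi tau lam r = r * pot tau lam r * phi tau lam r - r * ddphi tau lam r.
    by rewrite -ode; ring.
  rewrite /f /p /dphi_over /= e1; ring.
have ep := edecay_phi D; have eq_ := edecay_dphi D; have ev := edecay_pot_phi D.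
have cp := @phi_cont _ tau lam; have co := @dphi_over_cont _ tau lam.
have eM : edecay (fun x => 2 * (x - tau) * (x * p x * p x)).
  apply: edecay_eq (edecayD (edecayZ 2 (edecayX (edecay_mass D))) (edecayZ (- (2 * tau)) (edecay_mass D))) => x.
  by rewrite /p; ring.
have cM : continuous (fun x => 2 * (x - tau) * (x * p x * p x)).
  move=> x; apply: cvgM; last exact: cont_mass.
  by apply: cvgM; [exact: cvg_cst | apply: cvgB; [exact: cvg_id | exact: cvg_cst]].
have eO : edecay (fun x => p x * dphi_over tau lam x).
  exact: edecayM ep (edecay_dphi_over D).
have cO : continuous (fun x => p x * dphi_over tau lam x).
  by move=> x; apply: cvgM; [exact: cp | exact: co].
have eG : edecay G.
  apply: edecay_eq (edecayD (edecayD (edecayM (edecayX ev) ep)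
    (edecayZ (-1) (edecayM (edecayX eq_) eq_))) (edecayZ (-1) (edecayM ep eq_))) => x.
  by rewrite /G /p /q /V; ring.
have cf : continuous f by move=> x; apply: cvgD; [exact: cO | exact: cM].
have G0 : G 0 = 0 by rewrite /G /q dphi0 !mul0r mulr0 !subr0.
have := edecay_FTC dG cf (edecayD eO eM) eG.
rewrite G0 oppr0 RintegralD//.
- by move/eqP; rewrite addr_eq0 => /eqP ->.
- exact: edecay_integrable cO eO.
- exact: edecay_integrable cM eM.
Qed.

Lemma normalized_eigenfunction tau lam z : eigenfunction tau lam z -> sqnorm_r z = 1%E ->
  exists c, [/\ aeeq z (scaled c (phi tau lam)), decaying tau lam & normc c ^+ 2 * mass tau lam = 1].
Proof.
move=> ef z1; have [c [c0 zc D]] := eigenfunction_phi ef; exists c; split=> //.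
have [mz _] : L2r z by case: ef => [[]].
by move: z1; rewrite (sqnorm_r_ae mz (cmeasurable_phi tau lam c) zc) sqnorm_r_mass// => -[].
Qed.

End SquareNorms.

(** * Counting eigenvalues *)
Section Counting.
Variable R : realType.
Implicit Types (tau lam nu x r a b e : R) (n : nat).
Local Open Scope fset_scope.
Local Open Scope card_scope.

Definition below tau lam : set R := [set nu | Defs.eigenvalue tau nu /\ nu < lam].

Lemma card_eq_fset (A : set R) n :
  A #= `I_n <-> exists2 X : {fset R}, A = [set` X] & #|` X| = n.
Proof.
split=> [An|[X -> hX]]; last exact/card_eq_fsetP.
exists (fset_set A); last exact: card_fset_set.
by rewrite fset_setK//; apply/finite_setP; exists n.
Qed.

Lemma nth_eigenvalueE tau n lam : nth_eigenvalue tau n lam <->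
  decaying tau lam /\ below tau lam #= `I_(n.-1).
Proof. by rewrite /nth_eigenvalue eigenvalueP. Qed.

(** A larger eigenvalue has at least one more eigenvalue below it. *)
Lemma nth_eigenvalue_unique tau n lam1 lam2 :
  nth_eigenvalue tau n lam1 -> nth_eigenvalue tau n lam2 -> lam1 = lam2.
Proof.
suff H l1 l2 : nth_eigenvalue tau n l1 -> nth_eigenvalue tau n l2 -> l1 < l2 -> False.
  by move=> h1 h2; have [h|h|//] := ltgtP lam1 lam2; [case: (H _ _ h1 h2 h)|case: (H _ _ h2 h1 h)].
move=> [E1 /card_eq_fset[F1 e1 c1]] [E2 /card_eq_fset[F2 e2 c2]] l12.
have in1 x : (x \in F1) <-> below tau l1 x by rewrite /below e1.
have in2 x : (x \in F2) <-> below tau l2 x by rewrite /below e2.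
have sub : F1 `<=` F2.
  apply/fsubsetP => x /in1 [h1 h2]; apply/in2; split=> //; exact: lt_trans l12.
have : l1 \in F1.
  rewrite (_ : F1 = F2); first by apply/in2; split.
  by apply/eqP; rewrite eqEfcard sub c1 c2 leqnn.
by move=> /in1[_]; rewrite ltxx.
Qed.

Lemma zeta_eq tau n lam : nth_eigenvalue tau n lam -> zeta n tau = lam.
Proof.
move=> h; rewrite /zeta; case: xgetP => [x _ hx|/(_ lam)//].
exact: nth_eigenvalue_unique hx h.
Qed.

(** The default value [0] of [zeta] is not in the spectrum, by
    [decaying_gt0]. *)
Lemma zeta_nth tau n : Defs.eigenvalue tau (zeta n tau) ->
  nth_eigenvalue tau n (zeta n tau).
Proof.
rewrite eigenvalueP /zeta; case: xgetP => [x -> //|_ /decaying_gt0].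
by rewrite ltxx.
Qed.

(** Compactness of the segment turns the local openness of
    [not_decaying_open] into a uniform one. *)
Lemma no_decaying_segment tau a b : (forall x, a <= x <= b -> ~ decaying tau x) ->
  exists2 d : R, 0 < d & forall tau' x, `|tau' - tau| < d -> a <= x <= b ->
    ~ decaying tau' x.
Proof.
move=> H.
have /compact_near_coveringP cpt := @segment_compact R a b.
have hx x : `[a, b]%classic x ->
    \forall x' \near x & t \near nbhs tau, ~ decaying t x'.
  rewrite /= in_itv/= => xab; have [d d0 hd] := not_decaying_open (H x xab).
  exists (ball x d, ball tau d); first by split; exact: nbhsx_ballx.
  move=> [y t] [/= yx tt]; apply: hd; by rewrite distrC.
have : nbhs tau (fun t => forall x, `[a, b]%classic x -> ~ decaying t x).
  exact: (cpt R (nbhs tau) (fun t x => ~ decaying t x) _ hx).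
move=> /nbhs_ballP[d /= d0 hd]; exists d => // t x tt xab.
apply: (hd t _ x); first by rewrite /ball /= distrC.
by rewrite /= in_itv.
Qed.

Lemma finite_max (X : {fset R}) : X != fset0 -> exists2 m, m \in X & forall x, x \in X -> x <= m.
Proof.
elim/finSet_rect: X => X IH /fset0Pn[x xX].
have [E|/IH H] := eqVneq (X `\ x) fset0.
  exists x => // y yX; have [->//|ne] := eqVneq y x.
  have : y \in X `\ x by rewrite !inE ne yX.
  by rewrite E inE.
have [m mX hm] := H (fproperD1 xX).
have [xm|mx] := leP x m.
  exists m; first by move: mX; rewrite !inE => /andP[].
  move=> y yX; have [->//|ne] := eqVneq y x.
  by apply: hm; rewrite !inE ne yX.
exists x => // y yX; have [->//|ne] := eqVneq y x.
by apply: le_trans (ltW mx); apply: hm; rewrite !inE ne yX.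
Qed.

(** Induction on [n]: the spectrum in the gaps between the first [n]
    eigenvalues stays empty by compactness, and near each of them there is
    exactly one eigenvalue. *)
Lemma nth_eigenvalue_perturb tau n lam : nth_eigenvalue tau n lam ->
  (0 < n)%N -> forall e, 0 < e -> exists2 d : R, 0 < d & forall tau', `|tau' - tau| < d ->
  exists2 lam', `|lam' - lam| < e & nth_eigenvalue tau' n lam'.
Proof.
case: n => // m + _; elim: m lam => [|k IH] lam /nth_eigenvalueE[D /= cB] e e0.
- have [dl [dl0 uniq near]] := decaying_perturb D.
  pose e1 : R := Num.min e dl.
  have e10 : 0 < e1 by rewrite lt_min e0.
  have [e1e e1l] : e1 <= e /\ e1 <= dl by rewrite !ge_min !lexx orbT.
  have [|d1 d10 h1] := @no_decaying_segment tau 0 (lam - e1).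
    move=> x /andP[x0 xl] Dx; have : below tau lam x.
      by split; [exact/eigenvalueP | lra].
    by move: cB; rewrite II0 card_eq0 => /eqP ->.
  have [d2 d20 h2] := near e1 e10.
  exists (Num.min dl (Num.min d1 d2)); first by rewrite !lt_min dl0 d10.
  move=> tau'; rewrite !lt_min => /and3P[tl t1 t2].
  have [lam' hl D'] := h2 _ t2; exists lam'; first exact: lt_le_trans e1e.
  apply/nth_eigenvalueE; split=> //=.
  suff -> : below tau' lam' = set0 by rewrite II0; exact: card_eq00.
  apply/seteqP; split=> // x [/eigenvalueP Dx xl].
  have x0 := decaying_gt0 Dx.
  have [xe|ex] := leP x (lam - e1); first by apply: h1 t1 _ Dx; rewrite ltW.
  move: (hl); rewrite ltr_norml => /andP[l1 l2].
  have E : x = lam'.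
    apply: uniq tl _ _ Dx D'; last exact: lt_le_trans e1l.
    by rewrite ltr_norml; clear - l2 xl ex e1l; lra.
  by rewrite E ltxx in xl.
- move: cB => /card_eq_fset[X eX cX].
  have inX x : (x \in X) <-> below tau lam x by rewrite eX.
  have [|nu nuX numax] := @finite_max X; first by rewrite -cardfs_gt0 cX.
  have [/eigenvalueP Dnu nul] := (inX nu).1 nuX.
  have nthnu : nth_eigenvalue tau k.+1 nu.
    apply/nth_eigenvalueE; split=> //=; apply/card_eq_fset; exists (X `\ nu).
      apply/seteqP; split=> x /=.
        move=> [h1 h2]; rewrite !inE (lt_eqF h2) /=; apply/inX; split=> //.
        exact: lt_trans nul.
      rewrite !inE => /andP[ne /[dup] /numax le /inX[h1 _]]; split=> //.
      by rewrite lt_neqAle ne.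
    by move: cX; rewrite (cardfsD1 nu) nuX => -[].
  have [dl [dl0 uniq near]] := decaying_perturb D.
  have [dn [dn0 uniqn _]] := decaying_perturb Dnu.
  (* nu is the largest eigenvalue below lam.  With this e1 the neighbourhoods
     of nu and lam are disjoint and within the range of uniqueness. *)
  pose e1 : R := Num.min (Num.min e dl) (Num.min dn ((lam - nu) / 2)).
  have ln2 : 0 < (lam - nu) / 2 by rewrite divr_gt0 ?subr_gt0.
  have e10 : 0 < e1 by rewrite !lt_min e0 dl0 dn0.
  have [e1e e1l e1n e1g] : [/\ e1 <= e, e1 <= dl, e1 <= dn & e1 <= (lam - nu) / 2].
    by rewrite !ge_min !lexx !orbT.
  have [|d1 d10 h1] := @no_decaying_segment tau (nu + e1) (lam - e1).
    move=> x /andP[x0 xl] Dx; have /inX/numax : below tau lam x.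
      by split; [exact/eigenvalueP | lra].
    lra.
  have [d2 d20 h2] := near e1 e10.
  have [d3 d30 h3] := IH _ nthnu e1 e10.
  exists (Num.min (Num.min dl dn) (Num.min d1 (Num.min d2 d3))).
    by rewrite !lt_min dl0 dn0 d10 d20.
  move=> tau'; rewrite !lt_min => /andP[/andP[tl tn] /and3P[t1 t2 t3]].
  have [lam' hl D'] := h2 _ t2; exists lam'; first exact: lt_le_trans e1e.
  have [nu' hn /nth_eigenvalueE[Dn' /card_eq_fset[Y eY cY]]] := h3 _ t3.
  have inY x : (x \in Y) <-> below tau' nu' x by rewrite eY.
  move: (hl); rewrite ltr_norml => /andP[l1 l2].
  move: (hn); rewrite ltr_norml => /andP[n1 n2].
  have nl' : nu' < lam' by clear - n1 n2 l1 l2 e1g; lra.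
  apply/nth_eigenvalueE; split=> //=; apply/card_eq_fset; exists (nu' |` Y); last first.
    rewrite cardfsU1 cY /= (_ : nu' \notin Y)//.
    by apply/negP => /inY[_]; rewrite ltxx.
  apply/seteqP; split=> x /=; last first.
    rewrite !inE => /orP[/eqP->|/inY[h4 h5]]; first by split=> //; exact/eigenvalueP.
    by split=> //; exact: lt_trans nl'.
  move=> [/eigenvalueP Dx xl]; rewrite !inE.
  have [xn|nx|->//] := ltgtP x nu'; first by apply/orP; right; apply/inY; split=> //; exact/eigenvalueP.
  exfalso; have [xn|nx'] := ltP x (nu + e1)%R.
    have E : x = nu'.
      apply: uniqn tn _ _ Dx Dn'; last exact: lt_le_trans e1n.
      by rewrite ltr_norml; clear - n1 nx xn e1n; lra.
    by rewrite E ltxx in nx.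
  have [xe|ex] := leP x (lam - e1); first by apply: h1 t1 _ Dx; rewrite nx'.
  have E : x = lam'.
    apply: uniq tl _ _ Dx D'; last exact: lt_le_trans e1l.
    by rewrite ltr_norml; clear - l2 xl ex e1l; lra.
  by rewrite E ltxx in xl.
Qed.

End Counting.

(** * Differentiating an eigenvalue *)
Section Derivative.
Variable R : realType.
Implicit Types (tau lam x r a b e : R) (n : nat).
Local Notation mu := (@lebesgue_measure R).

(** On a bounded interval this is [phi_param_cont].  Beyond it both solutions
    are bounded by the same multiple of [exp (- r)], which is small compared
    with [exp (- r / 2)]. *)
Lemma decaying_close tau lam e : decaying tau lam -> 0 < e ->
  exists2 d : R, 0 < d & forall tau' lam', `|tau' - tau| < d -> `|lam' - lam| < d ->
   decaying tau' lam' -> forall r, 0 <= r ->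
   `|phi tau' lam' r - phi tau lam r| <= e * expR (- (1 / 2 * r)).
Proof.
move=> D e0; have [r0 F] := far_near tau lam.
have F0 : far tau lam r0 by apply: F; rewrite subrr normr0.
have r00 : 0 <= r0 by case: F0 => h _; lra.
pose A : R := (`|phi tau lam r0| + 1) * expR r0.
have A0 : 0 <= A by rewrite mulr_ge0 ?expR_ge0 ?addr_ge0.
have [b b0 hb] := expR_small e0 (addr_ge0 A0 A0).
pose B : R := Num.max r0 (2 * b).
have Br0 : r0 <= B by rewrite le_max lexx.
have Bb : 2 * b <= B by rewrite le_max lexx orbT.
pose eta : R := Num.min 1 (e * expR (- (1 / 2 * B))).
have eta0 : 0 < eta by rewrite lt_min ltr01 mulr_gt0 ?expR_gt0.
have [d d0 hd] := phi_param_cont tau lam B eta0.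
exists (Num.min 1 d); first by rewrite lt_min ltr01.
move=> tau' lam'; rewrite !lt_min => /andP[t1 t2] /andP[l1 l2] D' r rp.
have F' := F _ _ t1 l1.
have close x : 0 <= x <= B -> `|phi tau' lam' x - phi tau lam x| <= eta.
  by move=> h; have [] := hd _ _ t2 l2 x h.
have [rB|/ltW Br] := leP r B.
  apply: (le_trans (close r _)); first by rewrite rp.
  apply: (@le_trans _ _ (e * expR (- (1 / 2 * B)))); first by rewrite ge_min lexx orbT.
  by rewrite ler_pM2l// ler_expR; clear - rB; lra.
have h1 := recessive_bound (proj1 (decayingP F0) D) (le_trans Br0 Br).
have h2 := recessive_bound (proj1 (decayingP F') D') (le_trans Br0 Br).
have c0 : `|phi tau' lam' r0| <= `|phi tau lam r0| + 1.
  have := close r0; rewrite r00 Br0 => /(_ isT) h.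
  have e1 : eta <= 1 by rewrite ge_min lexx.
  rewrite -[phi tau' lam' r0](subrK (phi tau lam r0)) (le_trans (ler_normD _ _))//.
  by rewrite addrC lerD2l (le_trans h).
have k1 : `|phi tau lam r| <= A * expR (- r).
  by apply: (le_trans h1); rewrite ler_wpM2r ?expR_ge0// ler_wpM2r ?expR_ge0// lerDl.
have k2 : `|phi tau' lam' r| <= A * expR (- r).
  by apply: (le_trans h2); rewrite ler_wpM2r ?expR_ge0// ler_wpM2r ?expR_ge0.
rewrite (le_trans (ler_normB _ _))// (le_trans (lerD k2 k1))// -mulrDl.
have -> : - r = - (1 / 2 * r) + - (1 / 2 * r) by field.
rewrite expRD mulrA ler_wpM2r ?expR_ge0//; apply: ltW; apply: hb; clear - Bb Br; lra.
Qed.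

(** First order perturbation: integrating the derivative of the Wronskian of
    the solutions at [(tau', lam')] and [(tau, lam)] over the half-line. *)
Lemma eigenvalue_increment tau lam e : decaying tau lam -> 0 < e ->
  exists2 d : R, 0 < d & forall tau' lam', `|tau' - tau| < d -> `|lam' - lam| < d ->
   decaying tau' lam' ->
   `|(lam' - lam) * mass tau lam + (tau' - tau) * moment tau lam| <=
      e * (`|tau' - tau| + `|lam' - lam|).
Proof.
move=> D e0; have [C [C0 hC]] := decaying_C D.
pose q x : R := (x * (2 * `|tau| + 2 + 2 * x)) * expR (- (1 * x)).
have [k [Q [k0 Q0 hq]]] : edecay q.
  have eE : edecay (fun x : R => expR (- (1 * x))).
    by exists 1, 1; split=> // r _; rewrite ger0_norm ?expR_ge0// [leRHS]mul1r.
  apply: edecay_eq (edecayD (edecayZ (2 * `|tau| + 2) (edecayX eE)) (edecayZ 2 (edecayX (edecayX eE)))) => x.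
  by rewrite /q; ring.
(* S bounds the integral of the error term divided by e1; the two summands 1
   only ensure that it is positive. *)
pose S : R := (C + C ^+ 2 + 1) * (Q + 1) / k.
have S0 : 0 < S by rewrite divr_gt0// mulr_gt0 ?ltr_wpDl ?addr_ge0 ?sqr_ge0.
pose e1 : R := e / S.
have e10 : 0 < e1 by rewrite divr_gt0.
have [d1 d10 hd1] := decaying_close D e10.
exists (Num.min (Num.min 1 e1) d1); first by rewrite !lt_min ltr01 e10.
move=> tau' lam'; rewrite !lt_min => /andP[/andP[t1 t2] t3] /andP[_ l3] D'.
have close := hd1 _ _ t3 l3 D'.
set h := tau' - tau in t1 t2 *; set dl := lam' - lam.
set p := phi tau lam; set p' := phi tau' lam'.
pose V x := pot tau' lam' x - pot tau lam x.
have VE x : V x = h * (2 * tau + h - 2 * x) - dl by rewrite /V /pot /h /dl; ring.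
pose W r := r * dphi tau' lam' r * p r - p' r * (r * dphi tau lam r).
pose f r := V r * (r * p' r * p r).
have dW r : is_derive r 1 W (f r).
  have h1 := phi_drv tau lam r; have h2 := phi_drv tau' lam' r.
  have h3 := rdphi_drv tau lam r; have h4 := rdphi_drv tau' lam' r.
  by eapply drv_eq; [rewrite /W /p /p'; drv | rewrite /f /V /p /p' /=; ring].
have ep := edecay_phi D; have ep' := edecay_phi D'.
have cp := @phi_cont _ tau lam; have cp' := @phi_cont _ tau' lam'.
have em : edecay (fun r => r * p' r * p r) by exact: edecayM (edecayX ep') ep.
have cm : continuous (fun r => r * p' r * p r).
  by move=> x; apply: cvgM; [apply: cvgM; [exact: cvg_id|exact: cp'] | exact: cp].
have ef : edecay f.
  apply: edecay_eq (edecayD (edecayZ (h * (2 * tau + h) - dl) em) (edecayZ (- (2 * h)) (edecayX em))) => x.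
  by rewrite /f VE; ring.
have cf : continuous f.
  move=> x; apply: cvgM; last exact: cm.
  by apply: cvgB; exact: pot_cont.
have eW : edecay W.
  apply: edecay_eq (edecayD (edecayM (edecayX (edecay_dphi D')) ep)
     (edecayZ (-1) (edecayM (edecayX (edecay_dphi D)) ep'))) => x.
  by rewrite /W /p /p'; ring.
have W0 : W 0 = 0 by rewrite /W !mul0r mulr0 subrr.
have If := edecay_FTC dW cf ef eW; rewrite W0 oppr0 in If.
pose m r := r * p r * p r.
have emm : edecay m := edecay_mass D.
have cmm : continuous m := @cont_mass _ tau lam.
pose m2 r := 2 * (r - tau) * m r.
have em2 : edecay m2.
  apply: edecay_eq (edecayD (edecayZ 2 (edecayX emm)) (edecayZ (- (2 * tau)) emm)) => x.
  by rewrite /m2; ring.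
have cm2 : continuous m2.
  move=> x; apply: cvgM; last exact: cmm.
  by apply: cvgM; [exact: cvg_cst | apply: cvgB; [exact: cvg_id | exact: cvg_cst]].
pose lin r := dl * m r + h * m2 r.
have elin : edecay lin by exact: edecayD (edecayZ _ emm) (edecayZ _ em2).
have cZ (g : R -> R) a : continuous g -> continuous (fun x => a * g x).
  by move=> cg x; apply: cvgM; [exact: cvg_cst | exact: cg].
have clin : continuous lin.
  by move=> x; apply: cvgD; apply: cZ.
have Ilin : (\int[mu]_(x in `[0%R, +oo[) lin x = dl * mass tau lam + h * moment tau lam)%R.
  rewrite RintegralD//.
  - rewrite !RintegralZl//; exact: edecay_integrable.
  - by apply: edecay_integrable; [exact: cZ | exact: edecayZ].
  - by apply: edecay_integrable; [exact: cZ | exact: edecayZ].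
have Isum : (\int[mu]_(x in `[0%R, +oo[) (f x + lin x) = dl * mass tau lam + h * moment tau lam)%R.
  rewrite RintegralD//; first by rewrite If Ilin add0r.
  - exact: edecay_integrable.
  - exact: edecay_integrable.
rewrite -Isum.
(* What the linear part leaves: the change of the solution, and a term
   quadratic in h. *)
have dec x : f x + lin x = V x * (x * p x) * (p' x - p x) + h ^+ 2 * (x * p x * p x).
  by rewrite /f /lin /m2 /m VE; ring.
set H := `|h| + `|dl|.
have H0 : 0 <= H by rewrite addr_ge0.
have bound x : 0 <= x -> `|f x + lin x| <= (H * (e1 * (C + C ^+ 2)) * Q) * expR (- (k * x)).
  move=> x0; rewrite dec -mulrA.
  have [px _] := hC x x0; have dx := close x x0.
  have pxn : `|p x| <= C.
    by apply: (le_trans px); rewrite ler_piMr// -expR0 ler_expR oppr_le0.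
  have Vx : `|V x| <= H * (2 * `|tau| + 2 + 2 * x).
    rewrite VE (le_trans (ler_normB _ _))// normrM.
    have h1 : `|2 * tau + h - 2 * x| <= 2 * `|tau| + 2 + 2 * x.
      rewrite (le_trans (ler_normB _ _))// [X in _ + X]ger0_norm ?mulr_ge0// lerD2r.
      by rewrite (le_trans (ler_normD _ _))// normrM ger0_norm// lerD2l; clear - t1; lra.
    have h2 : 1 <= 2 * `|tau| + 2 + 2 * x by have tn := normr_ge0 tau; clear - tn x0; lra.
    by rewrite /H [leRHS]mulrDl lerD ?ler_wpM2l// ler_peMr.
  have b1 : `|V x * (x * p x) * (p' x - p x)| <= H * (e1 * C) * q x.
    rewrite !normrM (ger0_norm x0).
    apply: (@le_trans _ _ ((H * (2 * `|tau| + 2 + 2 * x)) * (x * (C * expR (- x))) * (e1 * 1))).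
      apply: ler_pM; rewrite ?mulr_ge0//.
        by apply: ler_pM; rewrite ?mulr_ge0// ler_wpM2l.
      have he : expR (- (1 / 2 * x)) <= expR 0 by rewrite ler_expR; clear - x0; lra.
      by rewrite expR0 in he; apply: (le_trans dx); rewrite ler_wpM2l ?(ltW e10).
    by rewrite /q mul1r le_eqVlt; apply/orP; left; apply/eqP; ring.
  have b2 : `|h ^+ 2 * (x * p x * p x)| <= H * (e1 * C ^+ 2) * q x.
    rewrite expr2 !normrM (ger0_norm x0).
    have hH : `|h| <= H by rewrite /H lerDl.
    apply: (@le_trans _ _ (H * e1 * (x * (C * expR (- x)) * C))).
      apply: ler_pM; rewrite ?mulr_ge0//; first by rewrite ler_pM// ltW.
      by apply: ler_pM; rewrite ?mulr_ge0// ler_wpM2l.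
    have -> : H * (e1 * C ^+ 2) * q x = H * e1 * (x * (C * expR (- x)) * C) * (2 * `|tau| + 2 + 2 * x).
      by rewrite /q mul1r; ring.
    rewrite ler_peMr//; last by have tn := normr_ge0 tau; clear - tn x0; lra.
    apply: mulr_ge0; last by rewrite !mulr_ge0 ?expR_ge0.
    by apply: mulr_ge0 => //; exact: ltW.
  rewrite (_ : V x * (x * p x * (p' x - p x)) = V x * (x * p x) * (p' x - p x)); last by rewrite mulrA.
  rewrite (le_trans (ler_normD _ _))// (le_trans (lerD b1 b2))//.
  rewrite -mulrDl -mulrDr -mulrDr -[leRHS]mulrA ler_wpM2l//.
    by rewrite mulr_ge0// mulr_ge0 ?(ltW e10)// addr_ge0 ?sqr_ge0.
  exact: le_trans (ler_norm _) (hq x x0).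
apply: (le_trans (edecay_Rintegral_le k0 _ bound)).
  by move=> x; apply: cvgD; [exact: cf | exact: clin].
rewrite (_ : e = e1 * S); last by rewrite /e1 divfK ?gt_eqF.
rewrite (_ : H * (e1 * (C + C ^+ 2)) * Q / k = e1 * ((C + C ^+ 2) * Q / k) * H); last by ring.
rewrite ler_wpM2r// ler_wpM2l ?(ltW e10)// /S ler_wpM2r ?invr_ge0 ?(ltW k0)//.
by apply: ler_pM; rewrite ?addr_ge0 ?sqr_ge0 ?lerDl.
Qed.

(** The Hellmann-Feynman formula for the regular solution, which is not
    normalized. *)
Lemma zeta_drv tau n : (0 < n)%N -> Defs.eigenvalue tau (zeta n tau) ->
  0 < mass tau (zeta n tau) ->
  is_derive tau 1 (@zeta R n) (- moment tau (zeta n tau) / mass tau (zeta n tau)).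
Proof.
move=> n0 E N0; have nth0 := zeta_nth E.
set lam := zeta n tau in E N0 nth0 *.
set N := mass tau lam in N0 *; set M := moment tau lam.
have D := (eigenvalueP tau lam).1 E.
have cont e : 0 < e -> exists2 d : R, 0 < d & forall tau', `|tau' - tau| < d ->
    `|zeta n tau' - lam| < e /\ decaying tau' (zeta n tau').
  move=> e0; have [d d0 hd] := nth_eigenvalue_perturb nth0 n0 e0.
  exists d; [exact: d0 | move=> tau' /hd[lam' h h']].
  by rewrite (zeta_eq h'); split=> //; have [] := (nth_eigenvalueE _ _ _).1 h'.
have lim : h^-1 *: (zeta n (h *: 1 + tau) - zeta n tau) @[h --> 0^'] --> - M / N.
  apply/cvgrPdist_le => e e0.
  pose K : R := 2 * (`|M| + N) / N.
  have K0 : 0 <= K by rewrite divr_ge0 ?mulr_ge0 ?addr_ge0 ?(ltW N0).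
  pose e1 : R := Num.min (N / 2) (e * N / (1 + K)).
  have K1 : 0 < 1 + K by rewrite ltr_wpDr.
  have e10 : 0 < e1 by rewrite lt_min !divr_gt0 ?mulr_gt0.
  have e1N : e1 <= N / 2 by rewrite ge_min lexx.
  have e1e : e1 * (1 + K) <= e * N by rewrite -ler_pdivlMr// ge_min lexx orbT.
  have [d d0 hd] := eigenvalue_increment D e10.
  have [d' d'0 hd'] := cont d d0.
  rewrite /dnbhs /within /=; apply/nbhs_ballP; exists (Num.min d d') => /=.
    by rewrite lt_min d0.
  move=> h; rewrite /ball /= sub0r normrN lt_min => /andP[hd1 hd2] hn0.
  have ht : h *: 1 + tau - tau = h by rewrite addrK /GRing.scale /= mulr1.
  have [z1 z2] : `|zeta n (h *: 1 + tau) - lam| < d /\ decaying (h *: 1 + tau) (zeta n (h *: 1 + tau)).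
    by apply: hd'; rewrite ht.
  have := hd _ _ _ z1 z2; rewrite ht => /(_ hd1).
  set dl := zeta n _ - lam; rewrite -/N -/M => est.
  have hp : 0 < `|h| by rewrite normr_gt0.
  have dlN : `|dl| * N <= `|h| * `|M| + e1 * (`|h| + `|dl|).
    rewrite -{1}(gtr0_norm N0) -normrM -[dl * N](addrK (h * M)).
    by rewrite (le_trans (ler_normB _ _))// addrC -normrM lerD2l.
  have dlK : `|dl| <= K * `|h|.
    rewrite /K mulrAC ler_pdivlMr//.
    have : e1 * `|dl| <= N / 2 * `|dl| by rewrite ler_wpM2r.
    have : e1 * `|h| <= N / 2 * `|h| by rewrite ler_wpM2r.
    have := mulr_ge0 (ltW N0) (ltW hp).
    by move: dlN; rewrite mulrDr; lra.
  have -> : - M / N - h^-1 *: dl = - ((dl * N + h * M) / (h * N)).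
    by rewrite /GRing.scale /=; field; rewrite hn0 gt_eqF.
  rewrite normrN normrM normfV normrM (gtr0_norm N0) ler_pdivrMr ?mulr_gt0//.
  apply: (le_trans est); rewrite mulrCA.
  apply: (@le_trans _ _ (e1 * (1 + K) * `|h|)).
    by rewrite -mulrA ler_pM2l// mulrDl mul1r lerD2l.
  by rewrite mulrC ler_pM2l.
have dz : derivable (@zeta R n) tau 1 by apply/cvg_ex; eexists; exact: lim.
apply: DeriveDef => //; rewrite /derive; exact: cvg_lim lim.
Qed.

End Derivative.

(** * The pairing with the Neumann operator *)
Section NeumannPairing.
Variable R : realType.
Implicit Types (c : R[i]) (z : R -> R[i]) (tau lam r : R).
Local Notation mu := (@lebesgue_measure R).
Local Notation hl := (@halfline R).
Local Notation normc := (@ComplexField.Normc.normc R).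

(** On a radial eigenfunction the Neumann operator acts as multiplication by
    the eigenvalue plus [u' / r]. *)
Definition neumann_image tau lam c : R -> R[i] :=
  scaled c (fun r => lam * phi tau lam r + dphi_over tau lam r).

Lemma op_h_neumann_image tau lam c z : decaying tau lam -> L2r z ->
  aeeq z (scaled c (phi tau lam)) -> op_h tau z (neumann_image tau lam c).
Proof.
move=> D [mz _] zc; have cphi := @phi_cont _ tau lam.
split.
- split=> //; rewrite (sqnorm_ae mz (cmeasurable_phi tau lam c) zc).
  by have [] : L2 (scaled c (phi tau lam)) by apply: (@L2_scaled _ c _ _ cphi (edecay_phi D)).
- apply: (@L2_scaled _ c (fun r => lam * phi tau lam r + dphi_over tau lam r)) => //.
  + move=> x; apply: cvgD; last exact: dphi_over_cont.
    by apply: cvgM; [exact: cvg_cst | exact: cphi].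
  + by apply: edecayD; [apply: edecayZ; exact: edecay_phi | exact: edecay_dphi_over].
- exists (scaled c (phi tau lam)), (scaled c (dphi tau lam)), (scaled c (ddphi tau lam)).
  split=> //; first exact: dom_h_phi.
  apply: aeW_halfline => r r0; rewrite real_mul_scaled /neumann_image /scaled -mulrN -mulrDr.
  rewrite -rmorphN -rmorphD; congr (_ * _%:C).
  by rewrite /dphi_over /pot; ring.
Qed.

Lemma inner_neumann_image tau lam c z : decaying tau lam -> cmeasurable z ->
  aeeq z (scaled c (phi tau lam)) ->
  inner (fun r => neumann_image tau lam c r - lam%:C * z r) z =
  (normc c ^+ 2 * - moment tau lam)%:C.
Proof.
move=> D [mR mI] zc.
have cphi := @phi_cont _ tau lam; have co := @dphi_over_cont _ tau lam.
pose H := neumann_image tau lam c.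
have [mHR mHI] : cmeasurable H.
  apply: (@cmeasurable_scaled _ c (fun r => lam * phi tau lam r + dphi_over tau lam r)) => //.
  move=> x; apply: cvgD; last exact: co.
  by apply: cvgM; [exact: cvg_cst | exact: cphi].
pose g r := phi tau lam r * dphi_over tau lam r.
have cg : continuous g by move=> x; apply: cvgM; [exact: cphi | exact: co].
have eg : edecay g by apply: edecayM; [exact: edecay_phi | exact: edecay_dphi_over].
have prod r : z r = scaled c (phi tau lam) r ->
    (H r - lam%:C * z r) * conjc (z r) = (normc c ^+ 2 * g r)%:C.
  move=> ->; rewrite /H /neumann_image real_mul_scaled /scaled -mulrBr -rmorphB addrC addKr.
  rewrite normc_sqr /g; case: (c) => x y /=; simpc.
  by congr (_ +i* _); ring.
have ae_eq_R (f1 f2 : R -> R) : measurable_fun hl f1 -> measurable_fun hl f2 ->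
    f1 = f2 %[ae mu in hl] -> (\int[mu]_(r in hl) f1 r = \int[mu]_(r in hl) f2 r)%R.
  move=> m1 m2 f12; congr fine; apply: ae_eq_integral.
  - exact: measurable_halfline.
  - exact/measurable_EFinP.
  - exact/measurable_EFinP.
  - by move: f12; apply: (@filterS _ _ (ae_filter_ringOfSetsType mu)) => r h hr; rewrite /= h.
have meas_cst (a : R) (f : R -> R) : measurable_fun hl f -> measurable_fun hl (fun r => a * f r).
  by move=> mf; apply: measurable_funM => //; exact: measurable_cst.
rewrite /inner /cintegral -/H.
have -> : (\int[mu]_(r in hl) complex.Re ((H r - lam%:C * z r) * conjc (z r)))%R =
    (\int[mu]_(r in hl) (normc c ^+ 2 * g r))%R.
  apply: ae_eq_R.
  - have -> : (fun r => complex.Re ((H r - lam%:C * z r) * conjc (z r))) =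
      (fun r => (complex.Re (H r) - lam * complex.Re (z r)) * complex.Re (z r)
        + (complex.Im (H r) - lam * complex.Im (z r)) * complex.Im (z r)).
      by apply/funext => r; case: (H r) (z r) => [a b] [a' b'] /=; ring.
    by apply: measurable_funD; apply: measurable_funM => //;
      apply: measurable_funB => //; exact: meas_cst.
  - by apply: continuous_measurable_on => x; apply: cvgM; [exact: cvg_cst | exact: cg].
  - move: zc; apply: (@filterS _ _ (ae_filter_ringOfSetsType mu)) => r h hr.
    by rewrite prod// h.
have -> : (\int[mu]_(r in hl) complex.Im ((H r - lam%:C * z r) * conjc (z r)))%R =
    (\int[mu]_(r in hl) (0 : R))%R.
  apply: ae_eq_R.
  - have -> : (fun r => complex.Im ((H r - lam%:C * z r) * conjc (z r))) =
      (fun r => (complex.Im (H r) - lam * complex.Im (z r)) * complex.Re (z r)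
        - (complex.Re (H r) - lam * complex.Re (z r)) * complex.Im (z r)).
      by apply/funext => r; case: (H r) (z r) => [a b] [a' b'] /=; ring.
    by apply: measurable_funB; apply: measurable_funM => //;
      apply: measurable_funB => //; exact: meas_cst.
  - exact: measurable_cst.
  - move: zc; apply: (@filterS _ _ (ae_filter_ringOfSetsType mu)) => r h hr.
    by rewrite prod// h.
have -> : (\int[mu]_(r in hl) (0 : R))%R = 0 by rewrite /Rintegral integral0.
have -> : (\int[mu]_(r in hl) (normc c ^+ 2 * g r))%R =
    (\int[mu]_(r in `[0%R, +oo[) (normc c ^+ 2 * g r))%R.
  congr fine; rewrite integral_halfline//.
  apply/measurable_EFinP; apply: continuous_measurable_on => x.
  by apply: cvgM; [exact: cvg_cst | exact: cg].
rewrite RintegralZl//; last exact: edecay_integrable.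
by rewrite virial.
Qed.

End NeumannPairing.

Unset Implicit Arguments.
Theorem proposition3p1 (R : realType) (n : nat) (tau : R) (z : R -> R[i])
    (hn : (1 <= n)%N)
    (hz : eigenfunction tau (zeta n tau) z)
    (hnorm : sqnorm_r z = 1%E) :
  derivable (zeta n) tau 1 /\
  exists hzf : R -> R[i], op_h tau z hzf /\
    (derive1 (zeta n) tau)%:C =
      inner (fun r => hzf r - (zeta n tau)%:C * z r) z.
Proof.
have [c [zc D m1]] := normalized_eigenfunction hz hnorm.
have m0 : 0 < mass tau (zeta n tau).
  rewrite ltNge; apply/negP => m0.
  by have := mulr_ge0_le0 (sqr_ge0 (ComplexField.Normc.normc c)) m0; rewrite m1 ler10.
have [dz dzE] := zeta_drv hn (decaying_eigenvalue D) m0.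
split=> //; exists (neumann_image tau (zeta n tau) c).
have Lz : L2r z by case: hz => [[]].
split; first exact: op_h_neumann_image.
rewrite inner_neumann_image//; last by case: Lz.
rewrite derive1E dzE; congr (_%:C).
apply: (mulIf (lt0r_neq0 m0)).
by rewrite divfK ?gt_eqF// mulrAC m1 mul1r.
Qed.
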